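(* Let $p\in(1,\infty)$ and $q\in[1,\infty]$. Then there exist constants $c_{p,q},C_{p,q}>0$ depending only on $p$ and $q$ such that for every $N\ge1$ and all independent random variables $X_1,\ldots,X_N$ on a probability space with $\mathbb{E}[X_n]=0$ for $n=1,\ldots,N$, $$c_{p,q}\left\|\left(\sum_{n=1}^N|X_n|^2\right)^{1/2}\right\|_{L^{p,q}}\le\left\|\sum_{n=1}^N X_n\right\|_{L^{p,q}}\le C_{p,q}\left\|\left(\sum_{n=1}^N|X_n|^2\right)^{1/2}\right\|_{L^{p,q}}.$$
   Context: For a measure space $(X,\mu)$ (here the underlying probability space) and a measurable real- or complex-valued function $f$ on $X$, put $d_f(\lambda)=\mu(\{x\in X:|f(x)|>\lambda\})$ and let $f^*(t)=\inf\{\lambda>0:d_f(\lambda)\le t\}$ be the non-increasing rearrangement of $f$. For $p\in(1,\infty)$ and $q\in[1,\infty]$, define $$\|f\|_{L^{p,q}}=\begin{cases}\left(\int_0^\infty\left(t^{1/p}f^*(t)\right)^q\frac{dt}{t}\right)^{1/q}, & q<\infty,\\ \sup_{t>0}t^{1/p}f^*(t), & q=\infty,\end{cases}$$ with values in $[0,\infty]$. The Lorentz space $L^{p,q}(X)$ consists of all measurable $f$ for which this is finite. *)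

(* Defs.v *)
From HB Require Import structures.
From mathcomp Require Import all_boot all_order all_algebra.
From mathcomp Require Import all_classical all_reals all_analysis.
From mathcomp Require Import complex.

Set Implicit Arguments.
Unset Strict Implicit.
Unset Printing Implicit Defensive.

Import Order.TTheory GRing.Theory Num.Theory.
Import ComplexField.Normc.

Local Open Scope classical_set_scope.
Local Open Scope ring_scope.
Local Open Scope ereal_scope.

Section Lorentz.
Context (R : realType) (d : measure_display) (T : measurableType d).
Variable mu : {measure set T -> \bar R}.

(* Everything is stated for complex-valued functions; a real-valued function g
   is viewed as fun x => (g x)%:C, whose modulus [normc] is |g x|. *)

Definition distribution_fun (f : T -> R[i]) (l : R) : \bar R :=
  mu [set x | (l < normc (f x))%R].

(* The infimum is taken in \bar R, hence is +oo when no l qualifies. *)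
Definition rearrangement (f : T -> R[i]) (t : R) : \bar R :=
  ereal_inf [set l%:E | l in [set l : R | (0 < l)%R /\
                                          distribution_fun f l <= t%:E]].

(* The value at q = -oo is junk: only 1 <= q is meaningful. *)
Definition lorentz_norm (p : R) (q : \bar R) (f : T -> R[i]) : \bar R :=
  match q with
  | r%:E => (\int[lebesgue_measure]_(t in `]0%R, +oo[)
               (((t `^ p^-1)%:E * rearrangement f t) `^ r * (t^-1)%:E)) `^ r^-1
  | +oo => ereal_sup [set (t `^ p^-1)%:E * rearrangement f t
                     | t in [set t : R | (0 < t)%R]]
  | -oo => 0
  end.

End Lorentz.

Section RandomVariables.
Context (R : realType) (d : measure_display) (T : measurableType d).
Variable P : probability T R.

(* C is identified with R * R to carry its Borel sigma-algebra, which is the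
   product of the Borel sigma-algebras of R. *)
Definition complex_pair (z : R[i]) : R * R := (complex.Re z, complex.Im z).

Definition complex_rv (X : T -> R[i]) : Prop :=
  measurable_fun [set: T] (complex_pair \o X).

Definition centered (X : T -> R[i]) : Prop :=
  let re : T -> R := fun x => complex.Re (X x) in
  let im : T -> R := fun x => complex.Im (X x) in
  [/\ P.-integrable [set: T] (EFin \o re), P.-integrable [set: T] (EFin \o im),
      'E_P[re] = 0 & 'E_P[im] = 0].

Definition mutually_independent (d' : measure_display) (T' : measurableType d')
    (I : finType) (X : I -> T -> T') : Prop :=
  forall (J : {set I}) (B : I -> set T'),
    (forall i, i \in J -> measurable (B i)) ->
    P (\bigcap_(i in [set` J]) (X i @^-1` B i)) =
    \prod_(i in J) P (X i @^-1` B i).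

End RandomVariables.

(* Main.v *)
Require Import Defs.
From HB Require Import structures.
From mathcomp Require Import all_boot all_order all_algebra.
From mathcomp Require Import all_classical all_reals all_analysis.
From mathcomp Require Import complex.
From mathcomp Require Import measurable_realfun.
From mathcomp Require Import ring lra.
Import ComplexField.Normc.

(* Up to constants depending on p and q, the L^{p,q} norm on a probability space
   is the l^q norm of the dyadic sequence a_k(f) = 2^(-k/p) f^*(2^-k), k >= 0.
   Hence ||f|| <= C ||g|| follows as soon as a_k(f) is at most a constant times
   sup_j al^(-|k - j|) a_j(g) for some al > 1, and this is a condition on
   distribution functions only.  The theorem is obtained by chaining four such
   comparisons on T * T, where X~_n(x, y) = X_n(x) - X_n(y) and S~, Q~ are the sum
   and the square function of the X~_n:
   - the law of (X~_n)_n is invariant under sign changes, so Khintchine's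
     inequality bounds S~ by Q~, and Paley-Zygmund bounds Q~ by S~;
   - for a random vector Z and its symmetrization Z~, the tail of |Z~| is
     trivially bounded by that of |Z|;
   - if moreover E Z = 0, Jensen's inequality gives E|Z| <= E|Z~|, so
     |Z| <= 2 E|Z~| with probability at least 1/2 by Markov, and therefore
     P(|Z| > l) <= 2 P(|Z~| > l/2) whenever E|Z~| <= l/8.
   The last two points apply to Z = (Re S, Im S) and to the vector of all real
   and imaginary parts of the X_n, whose Euclidean norms are |S| and Q. *)

Set Implicit Arguments.
Unset Strict Implicit.
Unset Printing Implicit Defensive.

Import numFieldNormedType.Exports.
Import Order.TTheory GRing.Theory Num.Theory.

Local Open Scope classical_set_scope.
Local Open Scope ring_scope.

(** * Rearrangements and the dyadic form of the Lorentz norm *)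

Section Rearrangement.
Context {R : realType}.
Implicit Types (D : R -> \bar R) (p : R).

(** [rear] and [lorentz] take a distribution function instead of a random variable, so that
    variables on [T] and on [T * T] can be compared. *)
Definition rear D (t : R) : \bar R :=
  ereal_inf [set l%:E | l in [set l : R | 0 < l /\ (D l <= t%:E)%E]].

Definition lorentz p (q : \bar R) D : \bar R :=
  match q with
  | r%:E => ((\int[lebesgue_measure]_(t in `]0%R, +oo[)
               (((t `^ p^-1)%:E * rear D t) `^ r * (t^-1)%:E)) `^ r^-1)%E
  | +oo%E => ereal_sup [set ((t `^ p^-1)%:E * rear D t)%E
                       | t in [set t : R | (0 < t)%R]]
  | -oo%E => 0%E
  end.

Lemma lorentz_normE d (T : measurableType d) (P : probability T R) p q f :
  lorentz_norm P p q f = lorentz p q (distribution_fun P f).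
Proof. by []. Qed.

Definition is_distr D :=
  (forall l, (0 <= D l <= 1)%E) /\ (forall l m, l <= m -> (D m <= D l)%E).

Lemma rear_ge0 D t : (0 <= rear D t)%E.
Proof. by apply: le_ereal_inf_tmp => _ [l [l0 _] <-]; rewrite lee_fin ltW. Qed.

Lemma rear_le D t l : 0 < l -> (D l <= t%:E)%E -> (rear D t <= l%:E)%E.
Proof. by move=> l0 Dl; apply: ereal_inf_lbound; exists l. Qed.

(** [D] need not be right-continuous, so the infimum may fail to be attained; hence the strict
    inequality. *)
Lemma rear_lt D t l : is_distr D -> (rear D t < l%:E)%E -> (D l <= t%:E)%E.
Proof.
move=> [_ Dn] /ereal_inf_lt[_ [m [m0 Dm] <-]]; rewrite lte_fin => ml.
by apply: le_trans Dm; apply: Dn; exact: ltW.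
Qed.

Lemma rear_nincr D s t : s <= t -> (rear D t <= rear D s)%E.
Proof.
move=> st; apply: le_ereal_inf_tmp => _ [l [l0 Dl] <-].
by apply: rear_le => //; apply: le_trans Dl _; rewrite lee_fin.
Qed.

(** Total mass 1 enters here: only t < 1 contributes to the norm, which leaves the dyadic scales k
    >= 0. *)
Lemma rear_ge1 D t : is_distr D -> 1 <= t -> rear D t = 0%E.
Proof.
move=> [D01 _] t1; apply/eqP; rewrite eq_le rear_ge0 andbT.
apply/lee_addgt0Pr => e e0; rewrite add0e; apply: rear_le => //.
by have /andP[_ /le_trans] := D01 e; apply; rewrite lee_fin.
Qed.

Lemma measurable_rear D : measurable_fun setT (rear D).
Proof.
apply: (measurability _ (ErealGenOInfty.measurableE R)) => //.
move=> _ [_ [x ->] <-]; rewrite setTI.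
apply: is_interval_measurable => s t /= _ + z /andP[_ zt].
rewrite !in_itv /= !andbT => /lt_le_trans; apply; exact: rear_nincr.
Qed.

Lemma powR_half_exp (s : R) k : (2^-1 ^+ k) `^ s = (2 `^ s)^-1 ^+ k.
Proof.
elim: k => [|k IHk]; first by rewrite !expr0 powR1.
rewrite !exprS powRM ?exprn_ge0// ?invr_ge0// IHk; congr (_ * _).
have b0 : 2 `^ s != 0 :> R by rewrite gt_eqF// powR_gt0.
by apply: (mulIf b0); rewrite mulVf// -powRM ?invr_ge0// mulVf// powR1.
Qed.

(** The weight 2^(-k/p) is a natural power of b^-1, where b = 2^(1/p), so that index shifts are
    algebraic. *)
Definition dyad p D (k : nat) : \bar R :=
  (((2 `^ p^-1)^-1 ^+ k)%:E * rear D (2^-1 ^+ k))%E.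

Lemma dyad_ge0 p D k : (0 <= dyad p D k)%E.
Proof. by rewrite mule_ge0 ?rear_ge0// lee_fin exprn_ge0// invr_ge0 powR_ge0. Qed.

Lemma dyadic_itv_ex (t : R) : 0 < t -> t <= 1 ->
  exists k, 2^-1 ^+ k.+1 < t <= 2^-1 ^+ k.
Proof.
move=> t0 t1.
have ex : exists n, (2^-1 : R) ^+ n < t.
  have [n tn] : exists n : nat, t^-1 < n%:R.
    by exists (Num.bound t^-1); apply: archi_boundP; rewrite invr_ge0 ltW.
  exists n; rewrite exprVn -[ltRHS]invrK ltf_pV2 ?posrE ?exprn_gt0 ?invr_gt0//.
  by rewrite (lt_le_trans tn)// -natrX ler_nat ltnW// ltn_expl.
have [[|k] kt kmin] := ex_minnP ex.
  by move: kt; rewrite expr0 ltNge t1.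
exists k; rewrite kt /= leNgt; apply/negP => /kmin.
by rewrite ltnn.
Qed.

Definition dyadic_itv k : set R := `]2^-1 ^+ k.+1, 2^-1 ^+ k]%classic.

Lemma half_exp_gt0 k : 0 < 2^-1 ^+ k :> R.
Proof. by rewrite exprn_gt0// invr_gt0. Qed.

Lemma lebesgue_dyadic_itv k : lebesgue_measure (dyadic_itv k) = (2^-1 ^+ k.+1)%:E.
Proof.
rewrite /dyadic_itv lebesgue_measure_itv /= lte_fin.
have h : 2^-1 ^+ k.+1 < 2^-1 ^+ k :> R.
  by rewrite exprS gtr_pMl ?half_exp_gt0// invf_lt1// ltr1n.
rewrite h -EFinB exprS; congr (_%:E); lra.
Qed.

Lemma trivIset_dyadic_itv : trivIset setT dyadic_itv.
Proof.
have H i j t : (i < j)%N -> dyadic_itv i t -> dyadic_itv j t -> False.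
  rewrite /dyadic_itv /= !in_itv /= => ij /andP[it _] /andP[_ tj].
  have : 2^-1 ^+ j <= 2^-1 ^+ i.+1 :> R.
    by rewrite ler_wiXn2l// ?invr_ge0// invf_le1 ?ler1n.
  by move=> /(le_trans tj) /(lt_le_trans it); rewrite ltxx.
move=> i j _ _ [t [it jt]]; have [ij|ij|//] := ltngtP i j.
- by case: (H _ _ _ ij it jt).
- by case: (H _ _ _ ij jt it).
Qed.

Definition lorentz_fun p r D (t : R) : \bar R :=
  (((t `^ p^-1)%:E * rear D t) `^ r * (t^-1)%:E)%E.

Lemma le_poweR (x y : \bar R) (r : R) : 0 <= r -> (0 <= x)%E -> (x <= y)%E ->
  (x `^ r <= y `^ r)%E.
Proof.
move=> r0 x0 xy; apply: gt0_ler_poweR => //; rewrite in_itv /= leey andbT //.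
exact: le_trans xy.
Qed.

Lemma lorentz_fun_ge0 p r D t : 0 < t -> (0 <= lorentz_fun p r D t)%E.
Proof. by move=> t0; rewrite mule_ge0 ?poweR_ge0// lee_fin invr_ge0 ltW. Qed.

Lemma measurable_lorentz_fun p r D :
  measurable_fun (`]0, +oo[%classic : set R) (lorentz_fun p r D).
Proof.
apply: emeasurable_funM.
  apply: (measurableT_comp (measurable_poweR r)).
  apply: emeasurable_funM.
    by apply/measurable_EFinP; apply: measurable_funTS; exact: measurable_powR.
  by apply: measurable_funTS; exact: measurable_rear.
apply/measurable_EFinP.
apply: open_continuous_measurable_fun.
  exact: interval_open.
move=> t; rewrite inE /= in_itv /= andbT => t0; apply: inv_continuous.
by rewrite gt_eqF.
Qed.

(** The power is taken at the right endpoint and the rearrangement at the left one; this mismatch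
    costs the index shift and the factor 2^(1/p). *)
Lemma weight_rear_le p D k t : 0 < p -> dyadic_itv k t ->
  ((t `^ p^-1)%:E * rear D t <= (2 `^ p^-1)%:E * dyad p D k.+1)%E.
Proof.
move=> p0; rewrite /dyadic_itv /= in_itv /= => /andP[kt tk].
have t0 : 0 < t := lt_trans (half_exp_gt0 _) kt.
rewrite /dyad muleA -EFinM exprS mulrA mulfV ?gt_eqF ?powR_gt0// mul1r.
apply: lee_pmul; rewrite ?rear_ge0// ?lee_fin ?powR_ge0//.
- rewrite -powR_half_exp; apply: ge0_ler_powR; rewrite ?nnegrE ?invr_ge0//.
  + exact: ltW.
  + exact: ltW.
- by rewrite rear_nincr// ltW.
Qed.

Lemma weight_rear_ge p D k t : 0 < p -> dyadic_itv k t ->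
  ((2 `^ p^-1)^-1%:E * dyad p D k <= (t `^ p^-1)%:E * rear D t)%E.
Proof.
move=> p0; rewrite /dyadic_itv /= in_itv /= => /andP[kt tk].
have t0 : 0 < t := lt_trans (half_exp_gt0 _) kt.
rewrite /dyad muleA -EFinM -exprS.
apply: lee_pmul; rewrite ?rear_ge0// ?lee_fin ?exprn_ge0 ?invr_ge0 ?powR_ge0//.
- rewrite -powR_half_exp; apply: ge0_ler_powR; rewrite ?nnegrE ?invr_ge0//.
  + exact: ltW.
  + exact: ltW.
  + exact: ltW.
- by rewrite rear_nincr.
Qed.

Lemma lorentz_fun_le p r D k t : 0 < p -> 0 <= r -> dyadic_itv k t ->
  (lorentz_fun p r D t <=
   (((2 `^ p^-1)%:E * dyad p D k.+1) `^ r * (2 ^+ k.+1)%:E))%E.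
Proof.
move=> p0 r0 kt; have := kt; rewrite /dyadic_itv /= in_itv /= => /andP[k1 k2].
have t0 : 0 < t := lt_trans (half_exp_gt0 _) k1.
apply: lee_pmul; rewrite ?poweR_ge0//.
- by rewrite lee_fin invr_ge0 ltW.
- apply: le_poweR; rewrite ?weight_rear_le//.
  by rewrite mule_ge0 ?rear_ge0// lee_fin powR_ge0.
- rewrite lee_fin -[leRHS]invrK lef_pV2 ?posrE ?invr_gt0 ?exprn_gt0//.
  by rewrite -exprVn ltW.
Qed.

Lemma lorentz_fun_ge p r D k t : 0 < p -> 0 <= r -> dyadic_itv k t ->
  ((((2 `^ p^-1)^-1%:E * dyad p D k) `^ r * (2 ^+ k)%:E) <=
   lorentz_fun p r D t)%E.
Proof.
move=> p0 r0 kt; have := kt; rewrite /dyadic_itv /= in_itv /= => /andP[k1 k2].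
have t0 : 0 < t := lt_trans (half_exp_gt0 _) k1.
apply: lee_pmul; rewrite ?poweR_ge0//.
- apply: le_poweR; rewrite ?weight_rear_ge//.
  by rewrite mule_ge0 ?dyad_ge0// lee_fin invr_ge0 powR_ge0.
- rewrite lee_fin -[leLHS]invrK lef_pV2 ?posrE ?invr_gt0 ?exprn_gt0//.
  by rewrite -exprVn.
Qed.

Lemma lorentz_fun_eq0 p r D t : 0 < r -> is_distr D -> 1 < t ->
  lorentz_fun p r D t = 0%E.
Proof.
move=> r0 hD t1; rewrite /lorentz_fun rear_ge1// ?ltW// mule0.
by rewrite poweR0r ?gt_eqF// mul0e.
Qed.

Lemma measurable_dyadic_itv k : measurable (dyadic_itv k).
Proof. exact: measurable_itv. Qed.

Lemma lorentz_integral_series p r D : 0 < r -> is_distr D ->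
  (\int[lebesgue_measure]_(t in `]0%R, +oo[) lorentz_fun p r D t =
  \sum_(0 <= k <oo) \int[lebesgue_measure]_(t in dyadic_itv k) lorentz_fun p r D t)%E.
Proof.
move=> r0 hD.
have sub k : dyadic_itv k `<=` `]0, +oo[.
  move=> t; rewrite /dyadic_itv /= !in_itv /= andbT => /andP[kt _].
  exact: lt_trans (half_exp_gt0 _) kt.
have sub' : \bigcup_k dyadic_itv k `<=` `]0, +oo[ by apply: bigcup_sub => k _; exact: sub.
rewrite -ge0_integral_bigcup//=.
- rewrite integral_mkcond [RHS]integral_mkcond; congr (integral _ _ _).
  apply/funext => t; rewrite /patch.
  have [tU|tU] := boolP (t \in \bigcup_k dyadic_itv k).
    by rewrite ifT// inE; apply: sub'; rewrite inE in tU.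
  case: ifPn => //; rewrite inE /= in_itv /= andbT => t0.
  rewrite lorentz_fun_eq0// ltNge; apply: contra tU => t1.
  have [k kt] := dyadic_itv_ex t0 t1.
  by rewrite inE; exists k => //; rewrite /dyadic_itv /= in_itv.
- by move=> k; exact: measurable_dyadic_itv.
- apply: (measurable_funS _ _ (measurable_lorentz_fun p r D)) => //.
- move=> t /sub'; rewrite /= in_itv /= andbT; exact: lorentz_fun_ge0.
- exact: trivIset_dyadic_itv.
Qed.

Lemma integral_dyadic_cst k (c : \bar R) :
  (\int[lebesgue_measure]_(t in dyadic_itv k) cst c t = c * (2^-1 ^+ k.+1)%:E)%E.
Proof.
have := @integral_cst _ _ _ lebesgue_measure _ (measurable_dyadic_itv k) c.
by move=> ->; congr (_ * _)%E; exact: lebesgue_dyadic_itv.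
Qed.

Definition lqnorm (q : \bar R) (u : nat -> \bar R) : \bar R :=
  match q with
  | r%:E => ((\sum_(0 <= k <oo) u k `^ r) `^ r^-1)%E
  | +oo%E => ereal_sup (range u)
  | -oo%E => 0%E
  end.

Lemma lorentz_le_dyad p q : 0 < p -> (1%:E <= q)%E ->
  exists2 C : R, 0 < C & forall D, is_distr D ->
    (lorentz p q D <= C%:E * lqnorm q (dyad p D))%E.
Proof.
move=> p0 q1; exists (2 `^ p^-1); first by rewrite powR_gt0.
move=> D hD; case: q q1 => [r| |//]; rewrite ?lee_fin => r1 /=.
  have r0 : 0 < r by exact: lt_le_trans r1.
  set b := 2 `^ p^-1; have b0 : 0 < b by rewrite powR_gt0.
  suff : (\int[lebesgue_measure]_(t in `]0%R, +oo[) lorentz_fun p r D t <=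
      (b `^ r)%:E * \sum_(0 <= k <oo) dyad p D k `^ r)%E.
    move=> /(le_poweR (r := r^-1)); rewrite invr_ge0 ltW// => /(_ isT).
    rewrite integral_ge0; last first.
      by move=> t /=; rewrite in_itv /= andbT; exact: lorentz_fun_ge0.
    move=> /(_ isT); rewrite poweRM//; last 2 first.
    - by rewrite lee_fin powR_ge0.
    - by apply: nneseries_ge0 => k _ _; rewrite poweR_ge0.
    by rewrite poweR_EFin -powRrM mulfV ?gt_eqF// powRr1// ltW.
  rewrite lorentz_integral_series//.
  apply: (@le_trans _ _ (\sum_(0 <= k <oo) (b%:E * dyad p D k.+1) `^ r)%E).
    apply: lee_nneseries => k _.
      move=> _; apply: integral_ge0 => t; rewrite /dyadic_itv /= in_itv /= => /andP[kt _].
      by apply: lorentz_fun_ge0; exact: lt_trans kt.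
    (* The bound 2^(k+1) for 1/t cancels the interval length 2^-(k+1). *)
    apply: (@le_trans _ _ (((b%:E * dyad p D k.+1) `^ r * (2 ^+ k.+1)%:E) *
        (2^-1 ^+ k.+1)%:E)%E).
      rewrite -integral_dyadic_cst; apply: ge0_le_integral.
      - exact: measurable_dyadic_itv.
      - move=> t; rewrite /dyadic_itv /= in_itv /= => /andP[kt _].
        by apply: lorentz_fun_ge0; exact: lt_trans kt.
      - apply: (measurable_funS _ _ (measurable_lorentz_fun p r D)) => //.
        move=> t; rewrite /dyadic_itv /= !in_itv /= andbT => /andP[kt _].
        exact: lt_trans kt.
      - exact: measurable_cst.
      - by move=> t tk; apply: lorentz_fun_le => //; exact: ltW.
    by rewrite -muleA -EFinM -exprMn mulfV// expr1n mule1.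
  under eq_eseriesr => k _.
    rewrite poweRM ?dyad_ge0 ?lee_fin ?ltW//.
    rewrite poweR_EFin; over.
  rewrite nneseriesZl; last by move=> k _; rewrite poweR_ge0.
  apply: lee_pmul => //; first by rewrite lee_fin powR_ge0.
    by apply: nneseries_ge0 => k _ _; rewrite poweR_ge0.
  (* The terms have index [k.+1]; adding the nonnegative term k = 0 restores the full series. *)
  rewrite (nneseries_recl (f := fun k => (dyad p D k `^ r)%E))//; last first.
    by move=> k _; rewrite poweR_ge0.
  under eq_eseriesr => k _ do rewrite -addn1.
  rewrite (nneseries_addn (f := fun k => (dyad p D k `^ r)%E) 1); last first.
    by move=> k; rewrite poweR_ge0.
  by rewrite leeDr// poweR_ge0.
apply: ge_ereal_sup => _ [t t0 <-].
have [t1|t1] := leP t 1; last first.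
  rewrite rear_ge1 ?(ltW t1)// mule0 mule_ge0 ?lee_fin ?powR_ge0//.
  by apply: le_trans (dyad_ge0 p D 0) _; apply: ereal_sup_ubound; exists 0%N.
have [k kt] := dyadic_itv_ex t0 t1.
apply: le_trans (@weight_rear_le p D k t p0 _) _.
  by rewrite /dyadic_itv /= in_itv.
apply: lee_pmul; rewrite ?dyad_ge0 ?lee_fin ?powR_ge0//.
by apply: ereal_sup_ubound; exists k.+1.
Qed.

Lemma dyad_le_lorentz p q : 0 < p -> (1%:E <= q)%E ->
  exists2 C : R, 0 < C & forall D, is_distr D ->
    (lqnorm q (dyad p D) <= C%:E * lorentz p q D)%E.
Proof.
move=> p0; case: q => [r| |//]; last first.
  move=> _; exists 1 => // D hD; rewrite mul1e.
  apply: ge_ereal_sup => _ [k _ <-]; apply: ereal_sup_ubound.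
  by exists (2^-1 ^+ k); [exact: half_exp_gt0|rewrite powR_half_exp].
rewrite lee_fin => r1.
have r0 : 0 < r by exact: lt_le_trans r1.
set b := 2 `^ p^-1; have b0 : 0 < b by rewrite powR_gt0.
(* The factor 1/2 is the lower bound 2^k for 1/t times the length 2^-(k+1). *)
have c0 : 0 < (b^-1) `^ r / 2 by rewrite divr_gt0// powR_gt0// invr_gt0.
exists (((b^-1) `^ r / 2)^-1 `^ r^-1) => [|D hD]; first by rewrite powR_gt0// invr_gt0.
rewrite /= -poweR_EFin -poweRM ?lee_fin ?invr_ge0 ?(ltW c0)//; last first.
  by apply: integral_ge0 => t /=; rewrite in_itv /= andbT; exact: lorentz_fun_ge0.
apply: le_poweR; first by rewrite invr_ge0 ltW.
  by apply: nneseries_ge0 => k _ _; rewrite poweR_ge0.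
rewrite muleC lee_pdivlMr// muleC [leRHS]lorentz_integral_series//.
rewrite -nneseriesZl; last by move=> k _; rewrite poweR_ge0.
apply: lee_nneseries => k _.
  by move=> _; rewrite mule_ge0 ?poweR_ge0// lee_fin ltW.
apply: (@le_trans _ _ ((((b^-1)%:E * dyad p D k) `^ r * (2 ^+ k)%:E) * (2^-1 ^+ k.+1)%:E)%E).
  rewrite poweRM ?dyad_ge0 ?lee_fin ?invr_ge0 ?(ltW b0)// poweR_EFin.
  rewrite -!muleA -EFinM exprSr mulrA -exprMn mulfV// expr1n mul1r.
  by rewrite (muleC _ 2^-1%:E) muleA -EFinM.
rewrite -integral_dyadic_cst; apply: ge0_le_integral.
- exact: measurable_dyadic_itv.
- by move=> t _; rewrite mule_ge0 ?poweR_ge0.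
- exact: measurable_cst.
- apply: (measurable_funS _ _ (measurable_lorentz_fun p r D)) => //.
  move=> t; rewrite /dyadic_itv /= !in_itv /= andbT => /andP[kt _].
  exact: lt_trans kt.
- by move=> t tk; apply: lorentz_fun_ge => //; exact: ltW.
Qed.

End Rearrangement.

(** * Comparison of Lorentz norms *)

Section Comparison.
Context {R : realType}.
Implicit Types (F G : R -> \bar R) (p al K : R).

(** This is |k - j|: one of the truncated differences is always 0. *)
Definition ndist (k j : nat) := ((k - j) + (j - k))%N.

Lemma sum_geometric_dist (y : R) (j n : nat) : 0 <= y -> y < 1 ->
  \sum_(0 <= k < n) y ^+ ndist k j <= 2 / (1 - y).
Proof.
move=> y0 y1; rewrite ler_pdivlMr ?subr_gt0//.
(* A form that survives induction on [n]: up to j the partial sums grow geometrically, and past j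
   the missing tail y^(n - j) is recorded. *)
suff H : (\sum_(0 <= k < n) y ^+ ndist k j) * (1 - y) <=
    if (n <= j)%N then y ^+ (j.+1 - n) else 2 - y ^+ (n - j).
  apply: le_trans H _; case: ifP => _.
    by apply: (@le_trans _ _ 1); [exact: exprn_ile1 (ltW y1)|rewrite ler1n].
  by rewrite lerBlDr lerDl exprn_ge0.
elim: n => [|n IHn]; first by rewrite big_geq// mul0r leq0n exprn_ge0.
rewrite big_nat_recr//= mulrDl; apply: le_trans (lerD IHn (lexx _)) _.
rewrite /ndist; have [nj|jn|->] := ltngtP n j.
- have -> : (j.+1 - n = (j - n).+1)%N by rewrite subSn// ltnW.
  have -> : (n - j = 0)%N by apply/eqP; exact: ltnW.
  rewrite subSS add0n exprS.
  by move: (y ^+ (j - n)) => z; lra.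
- have -> : (n.+1 - j = (n - j).+1)%N by rewrite subSn// ltnW.
  have -> : (j - n = 0)%N by apply/eqP; exact: ltnW.
  rewrite addn0 exprS.
  by move: (y ^+ (n - j)) => z; lra.
- by rewrite subnn subSnn addn0 expr0 expr1; lra.
Qed.

(** This is al^|k - j| * 2^((j - k)/p); the quotient of powers with truncated exponents encodes the
    signed exponent. *)
Definition weight al p k j : R :=
  al ^+ ndist k j * ((2 `^ p^-1) ^+ (j - k) / (2 `^ p^-1) ^+ (k - j)).

Lemma weight_addr al p k m : weight al p k (k + m) = weight al p 0 m.
Proof. by rewrite /weight /ndist addKn sub0n subn0 (eqP (leq_addr _ _)). Qed.

(* Distribution-function form of
   [dyad p F k <= K^-1 * sup_j al^-|k - j| * dyad p G j]. *)
Definition dominated al p K F G :=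
  forall k (l : R), 0 < l ->
    (forall j, (G (K * weight al p k j * l)%R <= (2^-1 ^+ j)%:E)%E) ->
    (F l <= (2^-1 ^+ k)%:E)%E.

Lemma weight_gt0 al p k j : 0 < al -> 0 < weight al p k j.
Proof.
by move=> al0; rewrite mulr_gt0 ?exprn_gt0// divr_gt0// exprn_gt0// powR_gt0.
Qed.

(** [M] stands for any upper bound of the supremum over j, so that both the case q = +oo and an l^r
    norm for finite q are covered. *)
Lemma dyad_dominated al p K F G k (M : \bar R) :
  0 < al -> 0 < K -> is_distr G -> dominated al p K F G -> (0 <= M)%E ->
  (forall j, ((K^-1 * al^-1 ^+ ndist k j)%:E * dyad p G j <= M)%E) ->
  (dyad p F k <= M)%E.
Proof.
move=> al0 K0 hG FG; case: M => [M| |//]; last by move=> _ _; exact: leey.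
rewrite lee_fin => M0 GM; set b := 2 `^ p^-1.
have b0 : 0 < b by rewrite powR_gt0.
(* The slack [e] makes the bound on [rear G] strict, as [rear_lt] needs, and the test level (M + e)
   b^k positive even if M = 0. *)
apply/lee_addgt0Pr => e e0; rewrite -EFinD.
rewrite /dyad exprVn muleC lee_pdivrMr ?exprn_gt0// -EFinM.
have Me : 0 < M + e by rewrite ltr_wpDl.
have l0 : 0 < (M + e) * b ^+ k.
  rewrite mulr_gt0 ?exprn_gt0//.
apply: rear_le => //; apply: FG => // j; apply: rear_lt => //.
apply: (@le_lt_trans _ _ (K * weight al p k j * (M * b ^+ k))%:E); last first.
  have w0 : 0 < K * weight al p k j by rewrite mulr_gt0 ?weight_gt0.
  rewrite lte_fin (ltr_pM2l w0) ltr_pM2r ?exprn_gt0//; exact: ltr_pwDr.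
have := GM j; rewrite /dyad muleA -EFinM muleC.
rewrite -lee_pdivlMr; last first.
  by rewrite !mulr_gt0 ?exprn_gt0 ?invr_gt0.
move=> /le_trans; apply; rewrite -EFinM lee_fin le_eqVlt; apply/orP; left.
rewrite /weight -/b !exprVn; apply/eqP.
have bE : b ^+ (j - k) / b ^+ (k - j) * b ^+ k = b ^+ j.
  have [kj|/ltnW jk] := leqP k j.
    by rewrite (eqP kj) expr0 divr1 -exprD subnK.
  rewrite (eqP jk) expr0 div1r -{2}(subnK jk) exprD mulrA mulVf ?mul1r//.
  by rewrite expf_neq0// gt_eqF.
rewrite -bE.
have := gt_eqF K0; have := gt_eqF b0.
have := gt_eqF al0 => /negbT al1 /negbT b1 /negbT K1.
by field; rewrite ?K1 ?expf_neq0// b1.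
Qed.

(** For finite q = r the supremum over j is at most the l^r norm of the weighted terms. Exchanging
    the two sums leaves, for each j, the sum over k of y^|k - j| with y = al^-r < 1, which is
    bounded uniformly in j. *)
Lemma lqnorm_dominated al p K q : 1 < al -> 0 < K -> (1%:E <= q)%E ->
  exists2 C : R, 0 < C & forall F G, is_distr G -> dominated al p K F G ->
    (lqnorm q (dyad p F) <= C%:E * lqnorm q (dyad p G))%E.
Proof.
move=> al1 K0; have al0 : 0 < al by lra.
case: q => [r| |//]; last first.
  move=> _; exists K^-1; first by rewrite invr_gt0.
  move=> F G hG FG; apply: ge_ereal_sup => _ [k _ <-].
  have s0 : (0 <= lqnorm +oo (dyad p G))%E.
    by apply: le_trans (dyad_ge0 p G 0) _; apply: ereal_sup_ubound; exists 0%N.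
  apply: (dyad_dominated al0 K0 hG FG) => [|j].
    by rewrite mule_ge0// lee_fin invr_ge0 ltW.
  apply: lee_pmul; rewrite ?dyad_ge0//.
  - by rewrite lee_fin mulr_ge0 ?exprn_ge0 ?invr_ge0// ltW.
  - rewrite lee_fin ler_piMr ?invr_ge0 ?(ltW K0)// exprn_ile1 ?invr_ge0 ?(ltW al0)//.
    by rewrite invf_le1// ltW.
  - by apply: ereal_sup_ubound; exists j.
rewrite lee_fin => r1; have r0 : 0 < r by lra.
pose y := al^-1 `^ r.
have y0 : 0 < y by rewrite powR_gt0// invr_gt0.
have y1 : y < 1.
  have <- : 1 `^ r = 1 :> R by rewrite powR1.
  apply: gt0_ltr_powR; rewrite ?nnegrE ?invr_ge0 ?(ltW al0)//.
  by rewrite invf_lt1.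
pose c := K^-1 `^ r * (2 / (1 - y)).
have c0 : 0 < c by rewrite mulr_gt0 ?powR_gt0 ?invr_gt0// divr_gt0// subr_gt0.
exists (c `^ r^-1); first by rewrite powR_gt0.
move=> F G hG FG; rewrite /= -poweR_EFin -poweRM ?lee_fin ?(ltW c0)//; last first.
  by apply: nneseries_ge0 => k _ _; rewrite poweR_ge0.
apply: le_poweR; first by rewrite invr_ge0 ltW.
  by apply: nneseries_ge0 => k _ _; rewrite poweR_ge0.
pose v k j : \bar R := ((K^-1 * al^-1 ^+ ndist k j)%:E * dyad p G j)%E.
have v0 k j : (0 <= v k j)%E.
  by rewrite mule_ge0 ?dyad_ge0// lee_fin mulr_ge0 ?exprn_ge0 ?invr_ge0 ?ltW.
have vE k j : (v k j `^ r = (K^-1 `^ r * y ^+ ndist k j)%:E * dyad p G j `^ r)%E.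
  rewrite poweRM ?dyad_ge0 ?lee_fin ?mulr_ge0 ?exprn_ge0 ?invr_ge0 ?ltW//.
  rewrite poweR_EFin powRM ?exprn_ge0 ?invr_ge0 ?(ltW K0) ?(ltW al0)//.
  congr ((_ * _)%:E * _)%E; rewrite /y; elim: (ndist k j) => [|n IHn].
    by rewrite !expr0 powR1.
  by rewrite !exprS powRM ?exprn_ge0 ?invr_ge0 ?(ltW al0)// IHn.
apply: (@le_trans _ _ (\sum_(0 <= k <oo) \sum_(0 <= j <oo) v k j `^ r)%E).
  apply: lee_nneseries => k _; first by rewrite poweR_ge0.
  set S := (\sum_(0 <= j <oo) _)%E.
  have S0 : (0 <= S)%E by apply: nneseries_ge0 => j _ _; rewrite poweR_ge0.
  have rV (x : \bar R) : (0 <= x)%E -> ((x `^ r^-1) `^ r = x)%E.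
    by move=> x0; rewrite -poweRrM mulVf ?gt_eqF// poweRe1.
  have rV' (x : \bar R) : (0 <= x)%E -> ((x `^ r) `^ r^-1 = x)%E.
    by move=> x0; rewrite -poweRrM mulfV ?gt_eqF// poweRe1.
  rewrite -(rV S)//; apply: le_poweR; rewrite ?dyad_ge0 ?(ltW r0)//.
  apply: (dyad_dominated al0 K0 hG FG); first by rewrite poweR_ge0.
  move=> j; rewrite -/(v k j) -(rV' (v k j))//.
  apply: le_poweR; rewrite ?invr_ge0 ?(ltW r0) ?poweR_ge0//.
  rewrite /S (nneseriesD1 (n := j))//; last by move=> i _; rewrite poweR_ge0.
  by rewrite leeDl// nneseries_ge0// => i _ _; rewrite poweR_ge0.
rewrite nneseries_interchange; last by move=> i j; rewrite poweR_ge0.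
rewrite -nneseriesZl; last by move=> j _; rewrite poweR_ge0.
apply: lee_nneseries => j _.
  by move=> _; apply: nneseries_ge0 => i _ _; rewrite poweR_ge0.
apply: lime_le; first by apply: is_cvg_nneseries => i _ _; rewrite poweR_ge0.
apply: nearW => n.
under eq_bigr do rewrite vE.
rewrite -ge0_sume_distrl; last first.
  by move=> i _; rewrite lee_fin mulr_ge0 ?powR_ge0 ?exprn_ge0// ltW.
apply: lee_pmul; rewrite ?poweR_ge0//.
  by apply: sume_ge0 => i _; rewrite lee_fin mulr_ge0 ?powR_ge0 ?exprn_ge0// ltW.
rewrite sumEFin lee_fin -mulr_sumr /c ler_wpM2l ?powR_ge0//.
exact: sum_geometric_dist (ltW y0) y1.
Qed.

Lemma lorentz_dominated al p K q : 1 < al -> 0 < p -> 0 < K -> (1%:E <= q)%E ->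
  exists2 C : R, 0 < C & forall F G, is_distr F -> is_distr G ->
    dominated al p K F G -> (lorentz p q F <= C%:E * lorentz p q G)%E.
Proof.
move=> al1 p0 K0 q1.
have [C1 C10 H1] := lorentz_le_dyad p0 q1.
have [C2 C20 H2] := @lqnorm_dominated al p K q al1 K0 q1.
have [C3 C30 H3] := dyad_le_lorentz p0 q1.
exists (C1 * (C2 * C3)); first by rewrite !mulr_gt0.
move=> F G hF hG FG; rewrite !EFinM -!muleA.
apply: le_trans (H1 _ hF) _; rewrite lee_pmul2l//.
apply: le_trans (H2 _ _ hG FG) _; rewrite lee_pmul2l//.
exact: H3.
Qed.

End Comparison.

(** * Random signs *)

Section Signs.
Context {R : realType}.

(** Since 1 - x <= exp(-x), one has exp(x)(1 - x) <= 1, while (1 - x)(1 + x + 2x^2) = 1 + x^2(1 -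
    2x) >= 1. *)
Lemma expR_le_quadratic (x : R) : x <= 2^-1 -> expR x <= 1 + x + 2 * x ^+ 2.
Proof.
move=> x2; have e1 := expR_ge1Dx (- x); have e2 := expRxMexpNx_1 x.
have e0 := expR_gt0 x; have : expR x * (1 - x) <= 1 by rewrite -[leRHS]e2 ler_pM2l.
nra.
Qed.

(** For |x| <= 1/2 the quadratic bounds at x and -x add up to 2 + 4x^2; otherwise |x| <= 2x^2. *)
Lemma cosh_le (x : R) : expR x + expR (- x) <= 2 * expR (2 * x ^+ 2).
Proof.
have [x2|x2] := leP `|x| 2^-1.
  have := expR_ge1Dx (2 * x ^+ 2).
  have := @expR_le_quadratic x; have := @expR_le_quadratic (- x).
  move: x2; rewrite ler_norml sqrrN => /andP[x1 x2].
  move=> H1 H2 H3; have {}H1 : expR (- x) <= 1 - x + 2 * x ^+ 2 by apply: H1; lra.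
  by have {}H2 := H2 x2; lra.
have H : `|x| <= 2 * x ^+ 2 by rewrite -real_normK ?num_real//; nra.
have [H1 H2] : x <= 2 * x ^+ 2 /\ - x <= 2 * x ^+ 2.
  by split; apply: le_trans H; rewrite ?ler_norm// -normrN ler_norm.
have := H1; have := H2; rewrite -(ler_expR x) -(ler_expR (-x)); lra.
Qed.

(** Raise x/m <= exp(x/m) to the power m. *)
Lemma exprn_le_expR (x : R) m : 0 <= x -> x ^+ m <= m%:R ^+ m * expR x.
Proof.
case: m => [|m] x0; first by rewrite !expr0 mul1r; have := expR_ge1Dx x; lra.
set M : R := m.+1%:R; have M0 : 0 < M by rewrite ltr0n.
have -> : expR x = expR (x / M) ^+ m.+1 by rewrite -expRM_natl mulrC divfK// gt_eqF.
rewrite -exprMn lerXn2r ?nnegrE//.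
  by rewrite mulr_ge0 ?expR_ge0// ltW.
rewrite mulrC -ler_pdivrMr//; apply: le_trans (expR_ge1Dx _).
by rewrite lerDr.
Qed.

Variable I : finType.
Implicit Types (eps : {ffun I -> bool}).

Definition sgb (b : bool) : R := (-1) ^+ b.

(** Averages over signs are written as plain sums over sign patterns, hence the factors [2 ^+ #|I|]
    from here on. The sum factors into a product over i of exp(a_i) + exp(-a_i), to which [cosh_le]
    applies. *)
Lemma sum_sign_expR (a : I -> R) :
  \sum_(eps : {ffun I -> bool}) expR (\sum_i sgb (eps i) * a i) <=
  2 ^+ #|I| * expR (2 * \sum_i a i ^+ 2).
Proof.
under eq_bigr do rewrite expR_sum.
rewrite -(bigA_distr_bigA (fun i b => expR (sgb b * a i))).
rewrite mulr_sumr expR_sum -(prodr_const I) -big_split /=.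
apply: ler_prod => i _; rewrite big_bool /= /sgb expr1 expr0 mulN1r mul1r addrC.
by rewrite addr_ge0 ?expR_ge0//= cosh_le.
Qed.

Lemma sum_sign_even_moment (a : I -> R) M : (0 < M)%N ->
  \sum_(eps : {ffun I -> bool}) (\sum_i sgb (eps i) * a i) ^+ M.*2 <=
  2 ^+ #|I| * ((M.*2%:R ^+ M.*2 * (2 * expR 2)) * (\sum_i a i ^+ 2) ^+ M).
Proof.
move=> M0; set A := \sum_i a i ^+ 2; set m := M.*2.
have A0 : 0 <= A by apply: sumr_ge0 => i _; exact: sqr_ge0.
move: A0; rewrite le_eqVlt => /orP[/eqP A0|A0].
  have a0 i : a i = 0.
    apply/eqP; rewrite -sqrf_eq0; apply/eqP.
    by apply: (psumr_eq0P _ (esym A0)) => // j _; exact: sqr_ge0.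
  rewrite -A0 expr0n eqn0Ngt M0 !mulr0 big1// => eps _.
  rewrite big1 => [|i _]; last by rewrite a0 mulr0.
  by rewrite expr0n double_eq0 eqn0Ngt M0.
(* Normalization: the coefficients t a_i have square sum 1, so passing from the m-th power of the
   signed sum to exponentials costs only a constant. *)
pose t := (Num.sqrt A)^-1.
have t0 : 0 < t by rewrite invr_gt0 sqrtr_gt0.
have tA : t ^+ 2 * A = 1.
  by rewrite /t exprVn sqr_sqrtr ?(ltW A0)// mulVf// gt_eqF.
have tm : t ^+ m * A ^+ M = 1 by rewrite /m -mul2n exprM -exprMn tA expr1n.
have tm0 : 0 < t ^+ m by rewrite exprn_gt0.
rewrite -(ler_pM2l tm0) mulr_sumr.
have -> : t ^+ m * (2 ^+ #|I| * (m%:R ^+ m * (2 * expR 2) * A ^+ M)) =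
    m%:R ^+ m * (2 ^+ #|I| * expR 2 + 2 ^+ #|I| * expR 2) * (t ^+ m * A ^+ M).
  by move: (t ^+ m) (A ^+ M) (m%:R ^+ m) (2 ^+ #|I|) => u v w z; ring.
rewrite tm mulr1.
have E (s : R) : s ^+ 2 = 1 ->
    \sum_(eps : {ffun I -> bool}) expR (\sum_i sgb (eps i) * (s * t * a i)) <=
    2 ^+ #|I| * expR 2.
  move=> s2; apply: le_trans (sum_sign_expR _) _.
  under eq_bigr do rewrite !exprMn s2 mul1r.
  by rewrite -mulr_sumr tA mulr1.
have E1 := E 1 (expr1n _ _).
have E2 : \sum_(eps : {ffun I -> bool}) expR (\sum_i sgb (eps i) * (-1 * t * a i)) <=
    2 ^+ #|I| * expR 2.
  by apply: E; rewrite sqrrN expr1n.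
apply: le_trans (_ : m%:R ^+ m *
  (\sum_(eps : {ffun I -> bool}) expR (\sum_i sgb (eps i) * (1 * t * a i)) +
   \sum_(eps : {ffun I -> bool}) expR (\sum_i sgb (eps i) * (-1 * t * a i))) <= _); last first.
  by rewrite ler_wpM2l ?exprn_ge0// lerD.
rewrite -big_split /= mulr_sumr; apply: ler_sum => eps _.
set S := \sum_i _.
have -> : \sum_i sgb (eps i) * (1 * t * a i) = t * S.
  by rewrite mulr_sumr; apply: eq_bigr => i _; ring.
have -> : \sum_i sgb (eps i) * (-1 * t * a i) = - (t * S).
  by rewrite mulr_sumr -sumrN; apply: eq_bigr => i _; ring.
rewrite -exprMn; move: (t * S) => y.
have -> : y ^+ m = `|y| ^+ m.
  by rewrite /m -mul2n !exprM real_normK// num_real.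
apply: le_trans (exprn_le_expR m (normr_ge0 y)) _.
rewrite ler_wpM2l ?exprn_ge0//.
by case: (ger0P y) => _; rewrite ?lerDl ?lerDr expR_ge0.
Qed.

Lemma sum_sign_square (a : I -> R) :
  \sum_(eps : {ffun I -> bool}) (\sum_i sgb (eps i) * a i) ^+ 2 = 2 ^+ #|I| * \sum_i a i ^+ 2.
Proof.
have H i j : \sum_(eps : {ffun I -> bool}) sgb (eps i) * sgb (eps j) =
    2 ^+ #|I| * (i == j)%:R.
  (* The product of two signs becomes a product over all coordinates, so the sum over patterns
     factors; for i != j the factor at i vanishes. *)
  pose f k (b : bool) := (if k == i then sgb b else 1) * (if k == j then sgb b else 1).
  have E eps : sgb (eps i) * sgb (eps j) = \prod_k f k (eps k).
    rewrite /f big_split /= -!big_mkcond /= !big_pred1_eq //.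
  under eq_bigr do rewrite E.
  rewrite -(bigA_distr_bigA f); have [ij|ij] := eqVneq i j.
    rewrite mulr1 -(prodr_const I); apply: eq_bigr => k _.
    by rewrite big_bool /f ij; case: eqP; rewrite /sgb /=; lra.
  rewrite mulr0 (bigD1 i)//= big_bool /f eqxx (negbTE ij) /sgb /=.
  by rewrite expr1 expr0 !mulr1 addNr mul0r.
under eq_bigr do rewrite expr2 mulr_suml.
rewrite exchange_big /= mulr_sumr; apply: eq_bigr => i _.
under eq_bigr do rewrite mulr_sumr.
rewrite exchange_big /= (bigD1 i)//= [X in _ + X]big1 ?addr0 => [|j ji].
  under eq_bigr do rewrite mulrACA.
  by rewrite -mulr_suml H eqxx mulr1 expr2.
under eq_bigr do rewrite mulrACA.
by rewrite -mulr_suml H eq_sym (negbTE ji) mulr0 mul0r.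
Qed.

(** Squared modulus of a signed sum of complex numbers, [bool] indexing real and imaginary parts. *)
Definition sign_sqnorm (a : I -> bool -> R) eps : R :=
  \sum_b (\sum_i sgb (eps i) * a i b) ^+ 2.

Definition sqnorm2 (a : I -> bool -> R) : R := \sum_i \sum_b a i b ^+ 2.

Lemma sign_sqnorm_ge0 a eps : 0 <= sign_sqnorm a eps.
Proof. by apply: sumr_ge0 => b _; exact: sqr_ge0. Qed.

Lemma sqnorm2_ge0 a : 0 <= sqnorm2 a.
Proof. by apply: sumr_ge0 => i _; apply: sumr_ge0 => b _; exact: sqr_ge0. Qed.

Lemma sum_sign_sqnorm a :
  \sum_(eps : {ffun I -> bool}) sign_sqnorm a eps = 2 ^+ #|I| * sqnorm2 a.
Proof.
rewrite [LHS]exchange_big /sqnorm2 [in RHS]exchange_big /= mulr_sumr; apply: eq_bigr => b _.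
exact: sum_sign_square.
Qed.

(** 2^M comes from (u + v)^M <= 2^M (u^M + v^M), the next factor 2 from the two real coordinates,
    the rest from [sum_sign_even_moment]. *)
Definition khintchine_cst (M : nat) : R :=
  2 ^+ M * (2 * (M.*2%:R ^+ M.*2 * (2 * expR 2))).

Lemma khintchine_cst_gt0 M : 0 < khintchine_cst M.
Proof.
have m0 : 0 < M.*2%:R ^+ M.*2 :> R.
  by case: M => [|M]; [rewrite expr0|rewrite exprn_gt0// ltr0n].
by apply: mulr_gt0; [exact: exprn_gt0|rewrite !mulr_gt0// expR_gt0].
Qed.

Lemma sum_sign_moment a M : (0 < M)%N ->
  \sum_(eps : {ffun I -> bool}) sign_sqnorm a eps ^+ M <=
  2 ^+ #|I| * (khintchine_cst M * sqnorm2 a ^+ M).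
Proof.
move=> M0; rewrite /khintchine_cst; set c : R := M.*2%:R ^+ M.*2 * (2 * expR 2).
have c0 : 0 <= c by rewrite mulr_ge0 ?exprn_ge0 ?mulr_ge0 ?expR_ge0.
have H b : \sum_(eps : {ffun I -> bool}) ((\sum_i sgb (eps i) * a i b) ^+ 2) ^+ M <=
    2 ^+ #|I| * (c * sqnorm2 a ^+ M).
  under eq_bigr do rewrite -exprM mul2n.
  apply: le_trans (sum_sign_even_moment (a ^~ b) M0) _.
  rewrite ler_wpM2l ?exprn_ge0// ler_wpM2l// lerXn2r ?nnegrE ?sqnorm2_ge0//.
    by apply: sumr_ge0 => i _; exact: sqr_ge0.
  by apply: ler_sum => i _; rewrite big_bool; case: b; rewrite ?lerDl ?lerDr sqr_ge0.
apply: (@le_trans _ _ (2 ^+ M * \sum_b \sum_(eps : {ffun I -> bool})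
    ((\sum_i sgb (eps i) * a i b) ^+ 2) ^+ M)).
  rewrite exchange_big mulr_sumr; apply: ler_sum => eps _.
  rewrite /sign_sqnorm !big_bool /=.
  set u := _ ^+ 2; set v := _ ^+ 2.
  have u0 : 0 <= u by exact: sqr_ge0.
  have v0 : 0 <= v by exact: sqr_ge0.
  have p2 : 0 <= 2 ^+ M :> R by exact: exprn_ge0.
  clearbody u v.
  have [uv|/ltW vu] := leP u v.
    apply: (@le_trans _ _ ((2 * v) ^+ M)).
      by rewrite lerXn2r ?nnegrE; lra.
    by rewrite exprMn ler_wpM2l// lerDr exprn_ge0.
  apply: (@le_trans _ _ ((2 * u) ^+ M)).
    by rewrite lerXn2r ?nnegrE; lra.
  by rewrite exprMn ler_wpM2l// lerDl exprn_ge0.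
rewrite big_bool /=; have := H true; have := H false.
move: (\sum_(eps : {ffun I -> bool}) _) (\sum_(eps : {ffun I -> bool}) _) => x y.
set z := 2 ^+ #|I| * _ => xz yz.
have -> : 2 ^+ #|I| * (2 ^+ M * (2 * c) * sqnorm2 a ^+ M) = 2 ^+ M * (z + z).
  by rewrite /z; move: (2 ^+ M) (2 ^+ #|I|) (sqnorm2 a ^+ M) => u v w; ring.
by rewrite ler_wpM2l ?exprn_ge0// lerD.
Qed.

Lemma sign_tail a M (l : R) : (0 < M)%N -> 0 <= l ->
  l ^+ M * \sum_(eps : {ffun I -> bool}) (l < sign_sqnorm a eps)%R%:R <=
  2 ^+ #|I| * (khintchine_cst M * sqnorm2 a ^+ M).
Proof.
move=> M0 l0; apply: le_trans (sum_sign_moment a M0).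
rewrite mulr_sumr; apply: ler_sum => eps _.
have [h|h] := leP (sign_sqnorm a eps) l.
  by rewrite mulr0 exprn_ge0// sign_sqnorm_ge0.
by rewrite mulr1 lerXn2r ?nnegrE ?sign_sqnorm_ge0// ltW.
Qed.

(* Paley-Zygmund, from the pointwise bound
   [u <= A / 4 + u ^ 2 / (4 C A) + C A * (A / 4 < u)]. *)
Lemma sign_paley_zygmund a : 0 < sqnorm2 a ->
  2 ^+ #|I| <= 2 * khintchine_cst 2 *
    \sum_(eps : {ffun I -> bool}) (sqnorm2 a / 4 < sign_sqnorm a eps)%R%:R.
Proof.
set A := sqnorm2 a => A0; set C := khintchine_cst 2.
have C0 : 0 < C := khintchine_cst_gt0 2.
set n := \sum_(eps : {ffun I -> bool}) _.
have H : 2 ^+ #|I| * A <= 2 ^+ #|I| * (A / 4) +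
    (4 * C * A)^-1 * (2 ^+ #|I| * (C * A ^+ 2)) + C * A * n.
  rewrite -{1}sum_sign_sqnorm.
  apply: (@le_trans _ _ (\sum_(eps : {ffun I -> bool}) (A / 4 +
     (4 * C * A)^-1 * sign_sqnorm a eps ^+ 2 +
     C * A * (A / 4 < sign_sqnorm a eps)%R%:R))).
    apply: ler_sum => eps _; have := sign_sqnorm_ge0 a eps.
    move: (sign_sqnorm a eps) => u u0.
    have D0 : 0 < 4 * C * A by rewrite !mulr_gt0.
    have [h|h] := leP u (A / 4); last first.
      rewrite mulr1; suff H : u <= (4 * C * A)^-1 * u ^+ 2 + C * A.
        by apply: le_trans H _; rewrite lerD2r lerDr divr_ge0// ltW.
      rewrite -(ler_pM2l D0) mulrDr mulVKf ?gt_eqF//.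
      by have := sqr_ge0 (u - 2 * C * A); nra.
    rewrite mulr0 addr0; apply: le_trans h _; rewrite lerDl.
    by rewrite mulr_ge0 ?sqr_ge0// invr_ge0 ltW.
  rewrite !big_split /= -!mulr_sumr -/n; apply: lerD => //; apply: lerD.
    by rewrite sumr_const card_ffun card_bool -(mulr_natl 4^-1) natrX mulrCA.
  rewrite ler_wpM2l ?invr_ge0//; first by rewrite !mulr_ge0// ltW.
  exact: (sum_sign_moment a (isT : 0 < 2)%N).
have E : (4 * C * A)^-1 * (2 ^+ #|I| * (C * A ^+ 2)) = 2 ^+ #|I| * A / 4.
  by move: (2 ^+ #|I|) => z; field; rewrite !gt_eqF.
move: H; rewrite E => H; rewrite -(ler_pM2r A0).
by move: H; move: (2 ^+ #|I|) n => z n; lra.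
Qed.

End Signs.

(** * Symmetrization of independent variables *)

Section SwapInvariance.
Context {R : realType} {d d' : measure_display} {T : measurableType d}
  {T' : measurableType d'} (P : probability T R) {I : finType}.
Variable Y : I -> T -> T'.
Hypothesis mY : forall i, measurable_fun setT (Y i).
Hypothesis indY : mutually_independent P Y.

(** A pi-system generating the product sigma-algebra on families of pairs. *)
Definition rectangles : set (set (I -> T' * T')) :=
  [set C | exists B1 B2 : I -> set T',
    [/\ forall i, measurable (B1 i), forall i, measurable (B2 i) &
        C = [set z | forall i, B1 i (z i).1 /\ B2 i (z i).2]]].

Definition swap_if (e : I -> bool) (w : T * T) : I -> T' * T' :=
  fun i => if e i then (Y i w.2, Y i w.1) else (Y i w.1, Y i w.2).

Local Notation U := (g_sigma_algebraType rectangles).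

Lemma swap_if_rectangle e (B1 B2 : I -> set T') :
  swap_if e @^-1` [set z | forall i, B1 i (z i).1 /\ B2 i (z i).2] =
  (\bigcap_(i in [set` [set: I]%SET]) (Y i @^-1` (if e i then B2 i else B1 i))) `*`
  (\bigcap_(i in [set` [set: I]%SET]) (Y i @^-1` (if e i then B1 i else B2 i))).
Proof.
apply/seteqP; split => [[x y] /= H|[x y] /= [H1 H2] i].
  by split => i _ /=; have := H i; rewrite /swap_if; case: (e i) => -[].
have := H1 i; have := H2 i; rewrite /swap_if /= finset.in_setT.
by case: (e i) => /(_ isT) h1 /(_ isT) h2.
Qed.

Lemma measurable_bigcap_preimage (B : I -> set T') :
  (forall i, measurable (B i)) ->
  measurable (\bigcap_(i in [set` [set: I]%SET]) (Y i @^-1` B i)).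
Proof.
move=> mB; apply: fin_bigcap_measurable => [|i _]; first exact: finite_finset.
by rewrite -[X in measurable X]setTI; exact: mY.
Qed.

Lemma measurable_swap_if e : measurable_fun setT (swap_if e : T * T -> U).
Proof.
apply: (@measurability _ _ _ U setT (swap_if e) rectangles) => //.
move=> _ [_ [B1 [B2 [m1 m2 ->]]] <-]; rewrite setTI swap_if_rectangle.
by apply: measurableX; apply: measurable_bigcap_preimage => i; case: (e i).
Qed.

(** By uniqueness of measures it suffices to treat rectangles. There independence turns both sides
    into products over i of P(Y_i in B1 i) P(Y_i in B2 i), and a swap at i only exchanges the two
    factors. *)
Lemma swap_if_prob e (E : set U) : measurable E ->
  (P \x P)%E (swap_if e @^-1` E) = (P \x P)%E (swap_if (fun=> false) @^-1` E).
Proof.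
move=> mE.
pose m e : set U -> \bar R := pushforward (P \x P)%E (swap_if e : T * T -> U).
rewrite -[LHS]/(m e E) -[RHS]/(m (fun=> false) E) /m.
have rT : rectangles setT.
  exists (fun=> setT), (fun=> setT); split => //; apply/seteqP; split => //.
apply: (@measure_unique _ R U rectangles (fun=> setT)) => //.
- move=> _ _ [B1 [B2 [m1 m2 ->]]] [C1 [C2 [n1 n2 ->]]].
  exists (fun i => B1 i `&` C1 i), (fun i => B2 i `&` C2 i); split.
  + by move=> i; exact: measurableI.
  + by move=> i; exact: measurableI.
  + apply/seteqP; split => z /=.
      by move=> [h1 h2] i; have [? ?] := h1 i; have [? ?] := h2 i.
    by move=> h; split => i; have [[? ?] [? ?]] := h i.
- by rewrite bigcup_const.
- exact: measurable_swap_if.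
- exact: measurable_swap_if.
- move=> ? ? _ [B1 [B2 [m1 m2 ->]]] /=; rewrite /pushforward !swap_if_rectangle.
  rewrite !product_measure1E; try by apply: measurable_bigcap_preimage => i; case: (e i).
  have := indY (J := [set: I]%SET) (B := fun i => if e i then B2 i else B1 i).
  move=> /= ->; last by move=> i _; case: (e i).
  have := indY (J := [set: I]%SET) (B := fun i => if e i then B1 i else B2 i).
  move=> /= ->; last by move=> i _; case: (e i).
  have := indY (J := [set: I]%SET) (B := B1) => /= ->; last by [].
  have := indY (J := [set: I]%SET) (B := B2) => /= ->; last by [].
  rewrite -!big_split /=; apply: eq_bigr => i _.
  by case: (e i) => //; rewrite muleC.
- move=> ? _; rewrite /= /pushforward preimage_setT.
  by rewrite probability_setT ltry.
Qed.

Lemma measurable_coord1 i : measurable_fun setT (fun z : U => (z i).1).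
Proof.
move=> _ B mB; rewrite setTI; apply: sub_sigma_algebra.
exists (fun j => if j == i then B else setT), (fun=> setT); split => //.
- by move=> j; case: eqP.
- apply/seteqP; split => z /= h; first by move=> j; case: eqP => [->|].
  by have [] := h i; rewrite eqxx.
Qed.

Lemma measurable_coord2 i : measurable_fun setT (fun z : U => (z i).2).
Proof.
move=> _ B mB; rewrite setTI; apply: sub_sigma_algebra.
exists (fun=> setT), (fun j => if j == i then B else setT); split => //.
- by move=> j; case: eqP.
- apply/seteqP; split => z /= h; first by move=> j; case: eqP => [->|].
  by have [] := h i; rewrite eqxx.
Qed.

End SwapInvariance.

(** * Tails of square roots and integration of pointwise inequalities *)

Section Distribution.
Context {R : realType} {d : measure_display} {T : measurableType d}.
Variable P : probability T R.

Definition sqrt_dist (V : T -> R) (l : R) : \bar R :=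
  P [set x | l < Num.sqrt (V x)].

Lemma measurable_sqrt_gt (V : T -> R) l : measurable_fun setT V ->
  measurable [set x | l < Num.sqrt (V x)].
Proof.
move=> mV; have mS : measurable_fun setT (fun x => Num.sqrt (V x)).
  apply: measurableT_comp => //; apply: continuous_measurable_fun.
  exact: sqrt_continuous.
have := mS measurableT `]l, +oo[%classic (measurable_itv _); rewrite setTI.
by congr measurable; apply/seteqP; split => x /=; rewrite in_itv /= andbT.
Qed.

Lemma is_distr_sqrt_dist V : measurable_fun setT V -> is_distr (sqrt_dist V).
Proof.
move=> mV; split => [l|l m lm].
  by rewrite measure_ge0 probability_le1//; exact: measurable_sqrt_gt.
apply: le_measure; rewrite ?inE; do ?exact: measurable_sqrt_gt.
by move=> x /=; exact: le_lt_trans.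
Qed.

(** Obtained by integrating the pointwise inequality. This is how sign inequalities, proved for a
    fixed array of numbers, become inequalities between probabilities. *)
Lemma sum_measure_le (J K : finType) (E : J -> set T) (B : K -> set T) (c : K -> R) :
  (forall j, measurable (E j)) -> (forall k, measurable (B k)) ->
  (forall k, 0 <= c k) ->
  (forall x, \sum_j \1_(E j) x <= \sum_k c k * \1_(B k) x :> R) ->
  (\sum_j P (E j) <= \sum_k (c k)%:E * P (B k))%E.
Proof.
move=> mE mB c0 EB.
have PE (A : set T) : measurable A -> P A = (\int[P]_x (\1_A x)%:E)%E.
  by move=> mA; rewrite integral_indic ?setIT.
have mI (A : set T) : measurable A -> measurable_fun setT (fun x => (\1_A x)%:E : \bar R).
  by move=> mA; apply/measurable_EFinP; exact: measurable_indic.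
under eq_bigr do rewrite PE//.
have cPE k : ((c k)%:E * P (B k) = \int[P]_x ((c k)%:E * (\1_(B k) x)%:E))%E.
  by rewrite (PE _ (mB k)) ge0_integralZl ?lee_fin//; exact: mI.
under [leRHS]eq_bigr do rewrite cPE.
have mcI k : measurable_fun setT (fun x => (c k)%:E * (\1_(B k) x)%:E)%E.
  by apply: emeasurable_funM; [exact: measurable_cst|exact: mI].
have EI : (\sum_i (\int[P]_x (\1_(E i) x)%:E) = \int[P]_x \sum_i (\1_(E i) x)%:E)%E.
  by rewrite ge0_integral_sum// => i; exact: mI.
have BI : (\sum_k (\int[P]_x ((c k)%:E * (\1_(B k) x)%:E)) =
    \int[P]_x \sum_k ((c k)%:E * (\1_(B k) x)%:E))%E.
  by rewrite ge0_integral_sum// => k x _; rewrite mule_ge0 ?lee_fin.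
rewrite EI BI.
apply: ge0_le_integral => //.
- by move=> x _; apply: sume_ge0 => j _; rewrite lee_fin.
- by apply: emeasurable_sum => j; exact: mI.
- exact: emeasurable_sum.
- move=> x _; rewrite sumEFin.
  under [leRHS]eq_bigr do rewrite -EFinM.
  by rewrite sumEFin lee_fin.
Qed.

End Distribution.

(** * Tails of the symmetrized sum and of its square function *)

Section Symmetrized.
Context {R : realType} {d : measure_display} {T : measurableType d}.
Variables (P : probability T R) (I : finType) (Y : I -> T -> R * R).
Hypothesis mY : forall i, measurable_fun setT (Y i).
Hypothesis indY : mutually_independent P Y.

Definition coord (b : bool) (z : R * R) : R := if b then z.1 else z.2.

Lemma measurable_coord b : measurable_fun setT (coord b).
Proof. by case: b; [exact: measurable_fst|exact: measurable_snd]. Qed.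

Definition symm (w : T * T) (i : I) (b : bool) : R :=
  coord b (Y i w.1) - coord b (Y i w.2).

Definition sum_sq (w : T * T) : R := \sum_b (\sum_i symm w i b) ^+ 2.

Definition square_sq (w : T * T) : R := sqnorm2 (symm w).

Let P2 : probability _ R := (P \x P)%E.

Lemma measurable_symm i b : measurable_fun setT (fun w => symm w i b).
Proof.
apply: measurable_funB; apply: measurableT_comp (measurable_coord b) _;
  apply: measurableT_comp (mY i) _; [exact: measurable_fst|exact: measurable_snd].
Qed.

Lemma measurable_sign_sqnorm eps :
  measurable_fun setT (fun w => sign_sqnorm (symm w) eps).
Proof.
apply: measurable_sum => b; apply: measurable_funX; apply: measurable_sum => i.
by apply: measurable_funM; [exact: measurable_cst|exact: measurable_symm].
Qed.

Lemma measurable_sum_sq : measurable_fun setT sum_sq.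
Proof.
apply: measurable_sum => b; apply: measurable_funX; apply: measurable_sum => i.
exact: measurable_symm.
Qed.

Lemma measurable_square_sq : measurable_fun setT square_sq.
Proof.
apply: measurable_sum => i; apply: measurable_sum => b; apply: measurable_funX.
exact: measurable_symm.
Qed.

(** Swapping the two copies of Y_i changes the sign of [symm w i], so each sign pattern is realized
    by a swap and [swap_if_prob] applies to [H], which is [sum_sq] as a function of the family of
    pairs. *)
Lemma sign_dist eps l :
  sqrt_dist P2 (fun w => sign_sqnorm (symm w) eps) l = sqrt_dist P2 sum_sq l.
Proof.
pose H (z : I -> (R * R) * (R * R)) : R :=
  \sum_b (\sum_i (coord b (z i).1 - coord b (z i).2)) ^+ 2.
have mH : measurable_fun setT (H : g_sigma_algebraType (@rectangles _ (R * R)%type I) -> R).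
  apply: measurable_sum => b; apply: measurable_funX; apply: measurable_sum => i.
  by apply: measurable_funB; apply: measurableT_comp (measurable_coord b) _;
    [exact: measurable_coord1|exact: measurable_coord2].
have HE (e : I -> bool) w : H (swap_if Y e w) = \sum_b (\sum_i sgb (e i) * symm w i b) ^+ 2.
  apply: eq_bigr => b _; congr (_ ^+ 2); apply: eq_bigr => i _.
  by rewrite /swap_if /symm /sgb; case: (e i) => /=; ring.
have HE0 w : H (swap_if Y (fun=> false) w) = sum_sq w.
  rewrite HE; apply: eq_bigr => b _; congr (_ ^+ 2); apply: eq_bigr => i _.
  by rewrite /sgb expr0 mul1r.
have := swap_if_prob mY indY eps (E := [set z | l < Num.sqrt (H z)]).
move=> /(_ (measurable_sqrt_gt _ mH)) E.
rewrite /sqrt_dist; transitivity (P2 (swap_if Y eps @^-1` [set z | l < Num.sqrt (H z)])).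
  by congr (P2 _); apply/seteqP; split => w /=; rewrite HE.
rewrite [LHS]E; congr (P2 _); apply/seteqP; split => w /=; by rewrite HE0.
Qed.

(** Where the square function exceeds 2l, Paley-Zygmund gives a proportion at least 1/(2C) of sign
    patterns with signed sum above l, the factor 2 being sqrt 4. After integration all patterns
    contribute equally by [sign_dist]. *)
Lemma square_sq_dist_le l : 0 < l ->
  (sqrt_dist P2 square_sq (2 * l) <=
   (2 * khintchine_cst 2)%:E * sqrt_dist P2 sum_sq l)%E.
Proof.
move=> l0; set C := khintchine_cst 2; have C0 : 0 < C := khintchine_cst_gt0 2.
have n0 : 0 < 2 ^+ #|I| :> R by rewrite exprn_gt0.
pose c : R := 2 * C / 2 ^+ #|I|.
have c0 : 0 <= c by rewrite divr_ge0 ?mulr_ge0// ltW.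
have H : (\sum_(j : unit) P2 [set w | (2 * l < Num.sqrt (square_sq w))%R] <=
    \sum_(eps : {ffun I -> bool})
      c%:E * P2 [set w | (l < Num.sqrt (sign_sqnorm (symm w) eps))%R])%E.
  apply: sum_measure_le => // [_|eps|w].
  - exact: measurable_sqrt_gt measurable_square_sq.
  - exact: measurable_sqrt_gt (measurable_sign_sqnorm eps).
  rewrite big_const /= card_unit /= addr0 -mulr_sumr !indicE.
  have [|_] := boolP (w \in _); last first.
    by rewrite mulr_ge0// sumr_ge0// => eps _; rewrite indicE.
  rewrite inE /= => lw.
  have A0 : 0 < square_sq w.
    by rewrite -sqrtr_gt0; apply: lt_trans lw; rewrite mulr_gt0.
  rewrite /c mulrAC ler_pdivlMr// mul1r.
  apply: le_trans (sign_paley_zygmund A0) _.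
  rewrite ler_wpM2l ?mulr_ge0 ?(ltW C0)//; apply: ler_sum => eps _.
  rewrite indicE ler_nat; have [h|//] := boolP (square_sq w / 4 < sign_sqnorm (symm w) eps).
  rewrite mem_set//=; apply: (@lt_trans _ _ (Num.sqrt (square_sq w / 4))); last first.
    by rewrite ltr_sqrt//; apply: le_lt_trans h; rewrite divr_ge0// ltW.
  move: lw; rewrite -{1}(divfK (_ : 4 != 0) (square_sq w))//.
  rewrite sqrtrM ?divr_ge0 ?(ltW A0)//.
  have -> : Num.sqrt 4 = 2 :> R.
    by rewrite (_ : 4 = 2 ^+ 2 :> R) ?sqrtr_sqr ?ger0_norm// expr2 -natrM.
  by rewrite [ltRHS]mulrC ltr_pM2l.
have -> : sqrt_dist P2 square_sq (2 * l) =
    (\sum_(j : unit) P2 [set w | (2 * l < Num.sqrt (square_sq w))%R])%E.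
  by rewrite big_const /= card_unit /= adde0.
apply: le_trans H _.
have -> : (\sum_(eps : {ffun I -> bool})
    c%:E * P2 [set w | (l < Num.sqrt (sign_sqnorm (symm w) eps))%R] =
    \sum_(eps : {ffun I -> bool}) c%:E * sqrt_dist P2 sum_sq l)%E.
  by apply: eq_bigr => eps _; rewrite -(sign_dist eps).
rewrite -ge0_sume_distrl; last by move=> eps _; rewrite lee_fin.
rewrite sumEFin sumr_const card_ffun card_bool.
by rewrite -[c *+ _]mulr_natl natrX /c mulrC divfK// gt_eqF.
Qed.

(** Splits according to the size of the square function. Where it is at most L_i, the proportion of
    sign patterns with signed sum above l is at most C (L_i / l)^(2M) by [sign_tail]; where it
    exceeds L_n, the proportion is bounded by 1. *)
Lemma sum_sq_tail M (L : nat -> R) (l : R) n : (0 < M)%N -> 0 < l ->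
  (forall i, 0 <= L i) ->
  (sqrt_dist P2 sum_sq l <=
   \sum_(i < n.+1) (khintchine_cst M * (L i / l) ^+ M.*2)%:E *
      (if i : nat is j.+1 then sqrt_dist P2 square_sq (L j) else 1)
   + sqrt_dist P2 square_sq (L n))%E.
Proof.
move=> M0 l0 L0; set C := khintchine_cst M; have C0 : 0 < C := khintchine_cst_gt0 M.
have n0 : 0 < 2 ^+ #|I| :> R by rewrite exprn_gt0.
pose B (i : nat) : set (T * T) :=
  if i is j.+1 then [set w | L j < Num.sqrt (square_sq w)] else setT.
have mB i : measurable (B i).
  case: i => [|i]; [exact: measurableT|exact: measurable_sqrt_gt measurable_square_sq].
pose c (i : nat) : R := if i == n.+1 then 1 else C * (L i / l) ^+ M.*2.
have c0 i : 0 <= c i.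
  rewrite /c; case: ifP => // _.
  by rewrite mulr_ge0 ?exprn_ge0 ?divr_ge0 ?(ltW C0) ?(ltW l0).
have H : (\sum_(eps : {ffun I -> bool})
      P2 [set w | (l < Num.sqrt (sign_sqnorm (symm w) eps))%R] <=
    \sum_(i < n.+2) (2 ^+ #|I| * c i)%:E * P2 (B i))%E.
  apply: sum_measure_le => // [eps|i|w].
  - exact: measurable_sqrt_gt (measurable_sign_sqnorm eps).
  - by rewrite mulr_ge0// ltW.
  under [leRHS]eq_bigr do rewrite -mulrA.
  rewrite -mulr_sumr.
  have [i wB Hi] : exists2 i : 'I_n.+2, B i w &
      \sum_(eps : {ffun I -> bool}) \1_[set w | l < Num.sqrt (sign_sqnorm (symm w) eps)] w
      <= 2 ^+ #|I| * c i.
    (* For the least i such that the square function is at most L_i, minimality puts [w] in [B i];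
       if no such i exists, the last event, with c = 1, is used. *)
    have [[i wL]|wL] := pselect (exists i, (i < n.+1)%N && (Num.sqrt (square_sq w) <= L i)).
      have ex : exists i, (i < n.+1)%N && (Num.sqrt (square_sq w) <= L i) by exists i.
      have [k /andP[kn wk] kmin] := ex_minnP ex.
      exists (Ordinal (ltnW kn : k < n.+2)%N).
        rewrite /B /=; case: k kn wk kmin => // k kn wk kmin /=.
        rewrite ltNge; apply/negP => wLk; have := kmin k.
        by rewrite (ltnW kn) wLk ltnn => /(_ isT).
      rewrite /c /= (ltn_eqF kn).
      have lM : 0 < (l ^+ 2) ^+ M by rewrite !exprn_gt0.
      rewrite -(ler_pM2l lM).
      apply: (@le_trans _ _ ((l ^+ 2) ^+ M *
          \sum_(eps : {ffun I -> bool}) (l ^+ 2 < sign_sqnorm (symm w) eps)%R%:R)).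
        rewrite ler_pM2l//; apply: ler_sum => eps _; rewrite indicE ler_nat.
        have [|//] := boolP (w \in _); rewrite inE /= => lw.
        suff -> : l ^+ 2 < sign_sqnorm (symm w) eps by [].
        rewrite -(sqr_sqrtr (sign_sqnorm_ge0 (symm w) eps)).
        by rewrite ltrXn2r ?nnegrE ?sqrtr_ge0// ltW.
      apply: le_trans (sign_tail _ M0 (sqr_ge0 l)) _.
      rewrite [leRHS]mulrCA ler_wpM2l ?(ltW n0)// [leRHS]mulrCA ler_wpM2l ?(ltW C0)//.
      have -> : (l ^+ 2) ^+ M * (L k / l) ^+ M.*2 = (L k ^+ 2) ^+ M.
        by rewrite -mul2n exprM -exprMn -exprMn mulrC divfK ?gt_eqF.
      rewrite lerXn2r ?nnegrE ?sqnorm2_ge0 ?sqr_ge0//.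
      rewrite -(sqr_sqrtr (sqnorm2_ge0 (symm w))) lerXn2r ?nnegrE ?sqrtr_ge0//.
    exists ord_max.
      rewrite /B /= ltNge; apply/negP => h; apply: wL; exists n.
      by rewrite ltnSn.
    rewrite /c /= eqxx mulr1.
    apply: (@le_trans _ _ (\sum_(eps : {ffun I -> bool}) 1)).
      by apply: ler_sum => eps _; rewrite indicE lern1 leq_b1.
    by rewrite sumr_const card_ffun card_bool natrX.
  apply: le_trans Hi _; rewrite ler_wpM2l ?(ltW n0)//.
  rewrite (bigD1 i)//= indicE mem_set//= mulr1 lerDl.
  by apply: sumr_ge0 => k _; rewrite mulr_ge0.
have S1 : (\sum_(eps : {ffun I -> bool})
      P2 [set w | (l < Num.sqrt (sign_sqnorm (symm w) eps))%R] =
    (2 ^+ #|I|)%:E * sqrt_dist P2 sum_sq l)%E.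
  transitivity (\sum_(eps : {ffun I -> bool}) (1%:E * sqrt_dist P2 sum_sq l))%E.
    by apply: eq_bigr => eps _; rewrite mul1e -(sign_dist eps).
  rewrite -ge0_sume_distrl; last by move=> eps _; rewrite lee_fin.
  by rewrite sumEFin sumr_const card_ffun card_bool natrX.
move: H; rewrite S1.
under [X in (_ <= X)%E]eq_bigr do rewrite EFinM -muleA.
rewrite -ge0_sume_distrr; last by move=> i _; rewrite mule_ge0// lee_fin.
rewrite lee_pmul2l// => /le_trans; apply.
rewrite big_ord_recr /=; apply: leeD.
  apply: lee_sum => i _; rewrite /c /= ltn_eqF ?ltn_ord//.
  apply: lee_pmul => //.
    by rewrite lee_fin mulr_ge0 ?exprn_ge0 ?divr_ge0 ?(ltW C0) ?(ltW l0).
  by rewrite /B; case: (nat_of_ord i) => // ; rewrite probability_setT.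
by rewrite /c eqxx mul1e.
Qed.

End Symmetrized.

(** * Domination between the symmetrized sum and its square function *)

Lemma square_sq_dominated {R : realType} (al p : R) : 1 < al -> exists2 K : R, 0 < K &
  forall (d : measure_display) (T : measurableType d) (P : probability T R)
    (I : finType) (Y : I -> T -> R * R),
  (forall i, measurable_fun setT (Y i)) -> mutually_independent P Y ->
  dominated al p K (sqrt_dist (P \x P)%E (square_sq Y)) (sqrt_dist (P \x P)%E (sum_sq Y)).
Proof.
move=> al1; have al0 : 0 < al by lra.
(* The factor in front of the tail is at most 2^m and is absorbed by using the hypothesis at scale k
   + m. *)
have [m hm] : exists m, 2 * khintchine_cst 2 <= 2 ^+ m :> R.
  exists (Num.bound (2 * khintchine_cst 2 : R)); apply: ltW.
  apply: lt_le_trans (archi_boundP _) _.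
    by rewrite mulr_ge0// ltW// khintchine_cst_gt0.
  by rewrite -natrX ler_nat ltnW// ltn_expl.
(* This value makes the level at scale k + m equal to l / 2. *)
exists (2 * weight al p 0 m)^-1; first by rewrite invr_gt0 mulr_gt0 ?weight_gt0.
move=> d T P I Y mY indY k l l0 H.
have := H (k + m)%N; rewrite weight_addr => {}H.
have -> : l = 2 * (l / 2) by rewrite mulrC divfK.
apply: le_trans (square_sq_dist_le mY indY _) _; first by rewrite divr_gt0.
have {}H : (sqrt_dist (P \x P)%E (sum_sq Y) (l / 2) <= (2^-1 ^+ (k + m))%:E)%E.
  apply: le_trans H; rewrite le_eqVlt; apply/orP; left; apply/eqP; congr sqrt_dist.
  by rewrite invfM divfK ?gt_eqF ?weight_gt0// mulrC.
apply: (@le_trans _ _ ((2 ^+ m)%:E * (2^-1 ^+ (k + m))%:E)%E).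
  apply: lee_pmul => //; rewrite ?lee_fin ?mulr_ge0 ?(ltW (khintchine_cst_gt0 _))//.
by rewrite -EFinM lee_fin addnC exprD mulrA -exprMn mulfV// expr1n mul1r.
Qed.

Lemma sum_sq_dominated {R : realType} (al p : R) : 1 < al -> al < 2 `^ p^-1 ->
  exists2 K : R, 0 < K &
  forall (d : measure_display) (T : measurableType d) (P : probability T R)
    (I : finType) (Y : I -> T -> R * R),
  (forall i, measurable_fun setT (Y i)) -> mutually_independent P Y ->
  dominated al p K (sqrt_dist (P \x P)%E (sum_sq Y)) (sqrt_dist (P \x P)%E (square_sq Y)).
Proof.
move=> al1 alb; have al0 : 0 < al by lra.
set b := 2 `^ p^-1 in alb *; have b0 : 0 < b by lra.
have ab0 : 0 < al / b by rewrite divr_gt0.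
have ab1 : al / b < 1 by rewrite ltr_pdivrMr// mul1r.
(* For i <= k the weight is (al / b)^(k - i), and a high enough moment brings it below 4^-(k - i).
   Half of this decay compensates 2^-i against 2^-k; the other half makes the sum over i
   converge. *)
have [M [M0 hM]] : exists M, (0 < M)%N /\ (al / b) ^+ M.*2 <= 4^-1.
  have : (fun n => (al / b) ^+ n) @ \oo --> (0 : R).
    by apply: cvg_expr; rewrite ger0_norm ?ltW.
  move=> /cvgr0Pnorm_le /(_ 4^-1) /(_ _)[|n _ hn]; first by rewrite invr_gt0.
  exists n.+1; split => //.
  have hn' : (n <= n.+1.*2)%N by rewrite -addnn addSn ltnW// ltnS leq_addr.
  by have := hn _ hn'; rewrite /= ger0_norm// exprn_ge0// ltW.
set C : R := khintchine_cst M; have C0 : 0 < C := khintchine_cst_gt0 M.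
(* The second summand covers i = k + 1, where the weight is al * b. *)
pose D := 1 + (al * b) ^+ M.*2.
have D1 : 1 <= D by rewrite lerDl exprn_ge0// mulr_ge0// ltW.
have D0 : 0 < D by lra.
have CD0 : 0 < C * D by rewrite mulr_gt0.
(* Small enough for the terms i <= k + 1 to add up to at most half of 2^-k; the tail beyond level k
   + 1 is the other half. *)
pose K := (16 * (C * D) + 1)^-1.
have K0 : 0 < K by rewrite invr_gt0; lra.
have K1 : K <= 1 by rewrite /K invf_le1; lra.
have KCD : 8 * (C * D * K) <= 2^-1.
  by rewrite mulrA /K ler_pdivrMr; [|]; lra.
exists K => // d T P I Y mY indY k l l0 H.
pose L i := K * weight al p k i * l.
have w0 i : 0 <= weight al p k i by rewrite ltW// weight_gt0.
have L0 i : 0 <= L i.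
  by apply: mulr_ge0; [apply: mulr_ge0|]; [exact: ltW|exact: w0|exact: ltW].
apply: le_trans (sum_sq_tail mY indY k.+1 M0 l0 L0) _.
have hw i : (i < k.+2)%N -> weight al p k i ^+ M.*2 * 2^-1 ^+ i <=
    D * (2^-1 ^+ k * 2^-1 ^+ ndist i k).
  rewrite ltnS leq_eqVlt => /orP[/eqP ->|].
    rewrite /weight /ndist subSnn -/b (_ : (k - k.+1 = 0)%N); last by apply/eqP; rewrite subn_eq0.
    rewrite add0n addn0 !expr1 expr0 divr1 exprSr ler_wpM2r//.
    by rewrite lerDr.
  rewrite ltnS => ik; rewrite /weight /ndist -/b.
  have -> : (i - k = 0)%N by apply/eqP.
  rewrite addn0 add0n expr0 div1r -exprVn -exprMn exprAC.
  apply: (@le_trans _ _ (4^-1 ^+ (k - i) * 2^-1 ^+ i)).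
    by rewrite ler_wpM2r ?exprn_ge0// lerXn2r ?nnegrE ?exprn_ge0// ltW.
  have -> : 4^-1 = 2^-1 * 2^-1 :> R by lra.
  have e : 2^-1 ^+ (k - i) * 2^-1 ^+ i = 2^-1 ^+ k :> R by rewrite -exprD subnK.
  rewrite exprMn -mulrA e mulrC ler_peMl//.
apply: (@le_trans _ _ (\sum_(i < k.+2) (2 * (C * D * K) * (2^-1 ^+ k * 2^-1 ^+ ndist i k))%:E +
    (2^-1 ^+ k.+1)%:E)%E).
  apply: leeD; last exact: H.
  apply: lee_sum => i _.
  (* The i-th term carries the tail at level i - 1, at most 2^-(i - 1) = 2 * 2^-i; for i = 0 the
     trivial bound 1 <= 2 is used. *)
  apply: (@le_trans _ _ ((C * (L i / l) ^+ M.*2)%:E * (2 * 2^-1 ^+ i)%:E)%E).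
    apply: lee_pmul => //.
    - by rewrite lee_fin mulr_ge0 ?exprn_ge0 ?divr_ge0 ?(ltW l0) ?(ltW C0).
    - by case: (nat_of_ord i) => [|j]//; rewrite /sqrt_dist measure_ge0.
    - case: (nat_of_ord i) => [|j]; first by rewrite expr0 mulr1 lee_fin ler1n.
      by apply: le_trans (H j) _; rewrite exprS mulrA mulfV// mul1r.
  rewrite -EFinM lee_fin /L mulfK ?gt_eqF// exprMn.
  have KM : K ^+ M.*2 <= K.
    case: (M) M0 => // M' _; rewrite doubleS exprS ler_piMr ?(ltW K0)//.
    by rewrite exprn_ile1// ltW.
  apply: (@le_trans _ _ (2 * C * K * (weight al p k i ^+ M.*2 * 2^-1 ^+ i))).
    rewrite [leLHS](_ : _ = 2 * C * K ^+ M.*2 * (weight al p k i ^+ M.*2 * 2^-1 ^+ i)); last first.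
      by move: (K ^+ _) (weight al p k i ^+ _) (2^-1 ^+ i) => x y z; ring.
    rewrite ler_wpM2r ?mulr_ge0 ?exprn_ge0// ler_wpM2l//.
    by rewrite mulr_ge0// ltW.
  have := hw i (ltn_ord i).
  have CK0 : 0 < 2 * C * K by apply: mulr_gt0 => //; exact: mulr_gt0.
  rewrite -(ler_pM2l CK0) => /le_trans; apply.
  rewrite le_eqVlt; apply/orP; left; apply/eqP.
  by move: (2^-1 ^+ k) (2^-1 ^+ ndist i k) => x y; ring.
rewrite sumEFin -EFinD lee_fin -mulr_sumr -mulr_sumr.
have := @sum_geometric_dist R 2^-1 k k.+2.
have h0 : 0 <= 2^-1 :> R by rewrite invr_ge0.
have h1 : 2^-1 < 1 :> R by rewrite invf_lt1// ltr1n.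
rewrite big_mkord => /(_ h0 h1) hs.
have {}hs : \sum_(i < k.+2) 2^-1 ^+ ndist i k <= 4 :> R.
  by apply: le_trans hs _; rewrite ler_pdivrMr; lra.
have k0 : 0 <= 2^-1 ^+ k :> R by exact: exprn_ge0.
rewrite exprS; move: (C * D * K) KCD (mulr_gt0 CD0 K0) hs k0 => X X1 X0.
move: (\sum_(i < _) _) (2^-1 ^+ k) => S h S4 h0'.
have XS : X * S <= X * 4 by rewrite ler_pM2l.
have : h * (2 * (X * S)) <= h * 2^-1 by rewrite ler_wpM2l//; lra.
lra.
Qed.

(** * Random vectors and their symmetrizations *)

Section Desymmetrization.
Context {R : realType} {d : measure_display} {T : measurableType d}.
Variable P : probability T R.

(** The root is at most c plus the sum of c th^(j+1) over the levels c th^j that it exceeds; the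
    expectations form a geometric series of ratio th / 2 < 1. *)
Lemma integral_sqrt_levels (V : T -> R) (c th : R) :
  measurable_fun setT V -> 0 < c -> 1 < th -> th < 2 ->
  (forall j, (sqrt_dist P V (c * th ^+ j) <= (2^-1 ^+ j)%:E)%E) ->
  (\int[P]_x (Num.sqrt (V x))%:E <= (c * (1 + th * (2 / (1 - th / 2))))%:E)%E.
Proof.
move=> mV c0 th1 th2 H; have th0 : 0 < th by lra.
have mS : measurable_fun setT (fun x => Num.sqrt (V x)).
  apply: measurableT_comp => //; apply: continuous_measurable_fun.
  exact: sqrt_continuous.
pose A j : set T := [set x | c * th ^+ j < Num.sqrt (V x)].
have mA j : measurable (A j) by exact: measurable_sqrt_gt.
pose g j (x : T) : \bar R := ((c * th ^+ j.+1)%:E * (\1_(A j) x)%:E)%E.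
have g0 j x : (0 <= g j x)%E.
  by rewrite mule_ge0 ?lee_fin ?mulr_ge0 ?exprn_ge0 ?(ltW c0) ?(ltW th0).
have mI j : measurable_fun setT (fun x => (\1_(A j) x)%:E : \bar R).
  by apply/measurable_EFinP; exact: measurable_indic.
have mg j : measurable_fun setT (g j).
  by apply: emeasurable_funM; [exact: measurable_cst|exact: mI].
apply: (@le_trans _ _ (\int[P]_x (cst c%:E x + \sum_(0 <= j <oo) g j x))%E).
  apply: ge0_le_integral => //.
  - exact/measurable_EFinP.
  - apply: emeasurable_funD; first exact: measurable_cst.
    by apply: ge0_emeasurable_sum => // k x _ _; exact: g0.
  move=> x _ /=.
  have [n hn] : exists n, Num.sqrt (V x) <= c * th ^+ n.
    have th' : 0 < th - 1 by lra.
    pose n := Num.bound (Num.sqrt (V x) / c / (th - 1)).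
    exists n; rewrite mulrC -ler_pdivrMr//.
    have : Num.sqrt (V x) / c / (th - 1) < n%:R.
      by apply: archi_boundP; rewrite !divr_ge0 ?sqrtr_ge0 ?(ltW c0) ?(ltW th').
    rewrite ltr_pdivrMr// => /ltW/le_trans; apply.
    elim: (n) => [|m IHm]; first by rewrite mul0r exprn_ge0// ltW.
    have : 1 <= th ^+ m by rewrite exprn_ege1// ltW.
    rewrite exprS -natr1; move: (th ^+ m) IHm => z; nra.
  have ex : exists n, Num.sqrt (V x) <= c * th ^+ n by exists n.
  have [[|m] hm mmin] := ex_minnP ex.
    rewrite -[leLHS]adde0; apply: leeD; last by apply: nneseries_ge0.
    by rewrite lee_fin (le_trans hm)// expr0 mulr1.
  apply: (@le_trans _ _ (g m x)).
    rewrite /g indicE mem_set/= ?mule1 ?lee_fin//.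
    rewrite /A /= ltNge; apply/negP => /mmin; by rewrite ltnn.
  rewrite -[leLHS]add0e; apply: leeD; first by rewrite lee_fin ltW.
  rewrite (nneseriesD1 (n := m))//.
  by rewrite leeDl// nneseries_ge0.
rewrite ge0_integralD//; last 3 first.
- by move=> x _; rewrite lee_fin ltW.
- by move=> x _; apply: nneseries_ge0.
- by apply: ge0_emeasurable_sum => // k x _ _; exact: g0.
rewrite integral_cst// mulrDr mulr1 EFinD; apply: leeD.
  rewrite -[leRHS]mule1; apply: lee_pmul => //; first by rewrite lee_fin ltW.
  exact: probability_le1.
rewrite integral_nneseries//.
apply: (@le_trans _ _ (\sum_(0 <= j <oo) (c * th * (th / 2) ^+ j)%:E)%E).
  apply: lee_nneseries => j _; first by rewrite integral_ge0.
  rewrite ge0_integralZl//; last by rewrite lee_fin mulr_ge0 ?exprn_ge0 ?ltW.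
  rewrite integral_indic// setIT.
  apply: (@le_trans _ _ ((c * th ^+ j.+1)%:E * (2^-1 ^+ j)%:E)%E).
    by rewrite lee_pmul2l ?lte_fin ?mulr_gt0 ?exprn_gt0//; exact: H.
  by rewrite -EFinM lee_fin exprMn exprS mulrA mulrA.
apply: lime_le.
  apply: is_cvg_nneseries => j _ _.
  by rewrite lee_fin !mulr_ge0 ?exprn_ge0 ?divr_ge0 ?(ltW c0) ?(ltW th0).
apply: nearW => n; rewrite sumEFin lee_fin -mulr_sumr -mulrA.
rewrite ler_wpM2l ?(ltW c0)// ler_wpM2l ?(ltW th0)//.
have y0 : 0 <= th / 2 by lra.
have y1 : th / 2 < 1 by lra.
have := sum_geometric_dist 0 n y0 y1.
by under eq_bigr do rewrite /ndist subn0 sub0n addn0.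
Qed.

Lemma markov_sqrt (V : T -> R) (l : R) : measurable_fun setT V -> 0 < l ->
  (l%:E * sqrt_dist P V l <= \int[P]_x (Num.sqrt (V x))%:E)%E.
Proof.
move=> mV l0.
have mA : measurable [set x | l < Num.sqrt (V x)] by exact: measurable_sqrt_gt.
have mI : measurable_fun setT (fun x => (\1_[set x | l < Num.sqrt (V x)] x)%:E : \bar R).
  by apply/measurable_EFinP; exact: measurable_indic.
rewrite /sqrt_dist -[X in P X]setIT -integral_indic// -ge0_integralZl ?lee_fin ?(ltW l0)//.
apply: ge0_le_integral => //.
- by move=> x _; rewrite mule_ge0 ?lee_fin ?(ltW l0).
- by apply: emeasurable_funM; [exact: measurable_cst|exact: mI].
- apply/measurable_EFinP; apply: measurableT_comp => //.
  by apply: continuous_measurable_fun; exact: sqrt_continuous.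
- move=> x _; rewrite -EFinM lee_fin indicE.
  have [|_] := boolP (x \in _); last by rewrite mulr0 sqrtr_ge0.
  by rewrite inE /= mulr1 => /ltW.
Qed.

Context (J : finType).
Variable Z : J -> T -> R.
Hypothesis mZ : forall j, measurable_fun setT (Z j).

Definition vec_sq (x : T) : R := \sum_j Z j x ^+ 2.
Definition vec_diff_sq (w : T * T) : R := \sum_j (Z j w.1 - Z j w.2) ^+ 2.

Let P2 : probability _ R := (P \x P)%E.

Lemma measurable_vec_sq : measurable_fun setT vec_sq.
Proof. by apply: measurable_sum => j; apply: measurable_funX. Qed.

Lemma measurable_vec_diff_sq : measurable_fun setT vec_diff_sq.
Proof.
apply: measurable_sum => j; apply: measurable_funX; apply: measurable_funB;
  apply: measurableT_comp (mZ j) _; [exact: measurable_fst|exact: measurable_snd].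
Qed.

Lemma vec_sq_ge0 x : 0 <= vec_sq x.
Proof. by apply: sumr_ge0 => j _; exact: sqr_ge0. Qed.

(** Two vectors of norm at most l differ by at most 2l; the rest is a union bound. *)
Lemma vec_diff_dist_le l : 0 < l ->
  (sqrt_dist P2 vec_diff_sq (2 * l) <= 2%:E * sqrt_dist P vec_sq l)%E.
Proof.
move=> l0; pose A := [set x | l < Num.sqrt (vec_sq x)].
have mA : measurable A by exact: measurable_sqrt_gt measurable_vec_sq.
have mAT : measurable (A `*` (setT : set T)) by exact: measurableX.
have mTA : measurable ((setT : set T) `*` A) by exact: measurableX.
apply: (@le_trans _ _ (P2 ((A `*` setT) `|` (setT `*` A)))).
  apply: le_measure; rewrite ?inE.
  - exact: measurable_sqrt_gt measurable_vec_diff_sq.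
  - exact: measurableU.
  move=> [x y] /= h; have [hx|hx] := leP (Num.sqrt (vec_sq x)) l; last by left.
  have [hy|hy] := leP (Num.sqrt (vec_sq y)) l; last by right.
  exfalso.
  move: h; rewrite ltNge => /negP; apply.
  have -> : 2 * l = Num.sqrt ((2 * l) ^+ 2) by rewrite sqrtr_sqr ger0_norm// mulr_ge0// ltW.
  rewrite ler_wsqrtr//.
  have H u : Num.sqrt (vec_sq u) <= l -> vec_sq u <= l ^+ 2.
    by move=> h; rewrite -(sqr_sqrtr (vec_sq_ge0 u)) lerXn2r ?nnegrE ?sqrtr_ge0// ltW.
  apply: (@le_trans _ _ (2 * vec_sq x + 2 * vec_sq y)).
    rewrite /vec_sq !mulr_sumr -big_split /=; apply: ler_sum => j _ /=.
    by have := sqr_ge0 (Z j x + Z j y); nra.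
  by have := H _ hx; have := H _ hy; nra.
apply: le_trans (measureU2 _ _ _) _ => //.
have e1 : P2 (A `*` setT) = P A.
  transitivity (P A * P setT)%E; first exact: product_measure1E.
  by rewrite probability_setT mule1.
have e2 : P2 (setT `*` A) = P A.
  transitivity (P setT * P A)%E; first exact: product_measure1E.
  by rewrite probability_setT mul1e.
rewrite /sqrt_dist -/A -[2%:E]/(1%:E + 1%:E)%E ge0_muleDl// mul1e.
apply: leeD; [exact: (eq_ind_r (fun z => (z <= _)%E) (lexx _) e1)|].
exact: (eq_ind_r (fun z => (z <= _)%E) (lexx _) e2).
Qed.

Lemma sum_mul_le_sqrt (u v : J -> R) : \sum_j u j ^+ 2 = 1 ->
  `|\sum_j u j * v j| <= Num.sqrt (\sum_j v j ^+ 2).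
Proof.
move=> u1; set s : R := Num.sqrt _.
have V0 : 0 <= \sum_j v j ^+ 2 by apply: sumr_ge0 => j _; exact: sqr_ge0.
have sE : s ^+ 2 = \sum_j v j ^+ 2 by rewrite sqr_sqrtr.
have := sqrtr_ge0 (\sum_j v j ^+ 2); rewrite -/s le_eqVlt => /orP[/eqP s0|s0].
  rewrite big1 ?normr0 -?s0// => j _.
  have vs0 : \sum_j v j ^+ 2 = 0 by rewrite -sE -s0 expr0n.
  have : v j ^+ 2 = 0 by apply: (psumr_eq0P _ vs0) => // i _; exact: sqr_ge0.
  by move=> /eqP; rewrite sqrf_eq0 => /eqP ->; rewrite mulr0.
apply: le_trans (ler_norm_sum _ _ _) _.
(* AM-GM weighted by s, so that each of the two halves sums to s / 2. *)
apply: (@le_trans _ _ (\sum_j (2^-1 * s * u j ^+ 2 + 2^-1 / s * v j ^+ 2))).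
  apply: ler_sum => j _; rewrite normrM.
  rewrite -(real_normK (num_real (u j))) -(real_normK (num_real (v j))).
  move: `|u j| `|v j| => a b.
  have s1 : s * s^-1 = 1 by rewrite mulfV// gt_eqF.
  have t0 : 0 < s^-1 by rewrite invr_gt0.
  rewrite -(ler_pM2l s0) mulrDr [X in _ + X](_ : _ = 2^-1 * b ^+ 2 * (s * s^-1)); last by ring.
  by rewrite s1; have := sqr_ge0 (s * a - b); nra.
rewrite big_split /= -!mulr_sumr u1 -sE mulr1 -mulrA.
by rewrite expr2 mulKf ?gt_eqF//; lra.
Qed.

Hypothesis iZ : forall j, P.-integrable setT (EFin \o Z j).
Hypothesis Z0 : forall j, (\int[P]_x (Z j x)%:E = 0)%E.

(* Jensen: [Z x] is the mean of [Z x - Z y] over [y]; test it against the unit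
   vector [Z x / |Z x|]. *)
Lemma vec_norm_le_integral x :
  ((Num.sqrt (vec_sq x))%:E <=
   \int[P]_y (Num.sqrt (vec_diff_sq (x, y)))%:E)%E.
Proof.
have mS : measurable_fun setT (fun y => (Num.sqrt (vec_diff_sq (x, y)))%:E).
  apply/measurable_EFinP; apply: measurableT_comp.
    by apply: continuous_measurable_fun; exact: sqrt_continuous.
  exact: measurable_fun_pair2 measurable_vec_diff_sq.
have := sqrtr_ge0 (vec_sq x); rewrite le_eqVlt => /orP[/eqP <-|].
  by apply: integral_ge0 => y _; rewrite lee_fin sqrtr_ge0.
set n := Num.sqrt _ => n0; pose u j := Z j x / n.
have nE : n ^+ 2 = vec_sq x by rewrite sqr_sqrtr// vec_sq_ge0.
have u1 : \sum_j u j ^+ 2 = 1.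
  under eq_bigr do rewrite exprMn exprVn.
  by rewrite -mulr_suml -/(vec_sq x) nE mulfV// -nE expf_neq0// gt_eqF.
pose f j y : \bar R := ((u j)%:E * ((Z j x)%:E - (Z j y)%:E))%E.
have ic (c : R) : P.-integrable setT (EFin \o cst c) by exact: finite_measure_integrable_cst.
have iB j : P.-integrable setT (fun y => (Z j x)%:E - (Z j y)%:E)%E.
  exact: integrableB (ic _) (iZ j).
have if_ j : P.-integrable setT (f j) by exact: integrableZl.
have intf j : (\int[P]_y f j y = (u j * Z j x)%:E)%E.
  rewrite /f integralZl// [RHS]EFinM; congr (_ * _)%E.
  transitivity (\int[P]_y (cst (Z j x) y)%:E - \int[P]_y (Z j y)%:E)%E.
    exact: (integralB_EFin measurableT (ic (Z j x)) (iZ j)).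
  rewrite Z0 sube0.
  transitivity ((Z j x)%:E * P setT)%E; first exact: (integral_cst P measurableT (Z j x)%:E).
  by rewrite probability_setT mule1.
have intF : (\int[P]_y \sum_j f j y = n%:E)%E.
  rewrite (integral_sum measurableT if_).
  under eq_bigr do rewrite intf.
  rewrite sumEFin; congr (_%:E).
  under eq_bigr do rewrite /u mulrAC -expr2.
  by rewrite -mulr_suml -/(vec_sq x) -nE expr2 mulfK// gt_eqF.
have fE y : (\sum_j f j y)%E = (\sum_j u j * (Z j x - Z j y))%:E.
  by rewrite -sumEFin; apply: eq_bigr => j _; rewrite /f -EFinB -EFinM.
have mF : measurable_fun setT (fun y => \sum_j f j y)%E.
  by apply: emeasurable_sum => j; exact: measurable_int (if_ j).
have -> : n%:E = `|\int[P]_y \sum_j f j y|%E by rewrite intF gee0_abs// lee_fin ltW.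
apply: le_trans (le_abse_integral _ _ _) _ => //.
apply: ge0_le_integral => //.
- exact: measurableT_comp.
- move=> y _; rewrite fE /= lee_fin; exact: sum_mul_le_sqrt.
Qed.

Lemma vec_norm_integral_le :
  (\int[P]_x (Num.sqrt (vec_sq x))%:E <=
   \int[P2]_w (Num.sqrt (vec_diff_sq w))%:E)%E.
Proof.
have mS : measurable_fun setT (fun w => (Num.sqrt (vec_diff_sq w))%:E).
  apply/measurable_EFinP; apply: measurableT_comp.
    by apply: continuous_measurable_fun; exact: sqrt_continuous.
  exact: measurable_vec_diff_sq.
rewrite [leRHS](fubini_tonelli1 _ mS); last by move=> w; rewrite lee_fin sqrtr_ge0.
apply: ge0_le_integral => //.
- apply/measurable_EFinP; apply: measurableT_comp.
    by apply: continuous_measurable_fun; exact: sqrt_continuous.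
  exact: measurable_vec_sq.
- by apply: measurable_fun_fubini_tonelli_F => // w; rewrite lee_fin sqrtr_ge0.
- by move=> x _; exact: vec_norm_le_integral.
Qed.

End Desymmetrization.

(** A bound free of k, turning the levels of [dominated] into the geometric ones of
    [integral_sqrt_levels]. For j <= k the weight is at most 1 because al <= 2^(1/p). *)
Lemma weight_le {R : realType} (al p : R) k j : 0 < p -> 1 <= al -> al <= 2 `^ p^-1 ->
  weight al p k j <= (al * 2 `^ p^-1) ^+ j.
Proof.
move=> p0 al1 alb; set b := 2 `^ p^-1 in alb *.
have b1 : 1 <= b by lra.
have ab1 : 1 <= al * b by rewrite -[leLHS]mulr1 ler_pM.
have ab0 : 0 <= al * b by lra.
rewrite /weight -/b /ndist; have [kj|/ltnW jk] := leqP k j.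
  rewrite (eqP kj) expr0 divr1 add0n -exprMn.
  by rewrite ler_weXn2l// leq_subr.
rewrite (eqP jk) expr0 div1r addn0 -exprVn -exprMn.
apply: (@le_trans _ _ 1); last by rewrite exprn_ege1.
by rewrite exprn_ile1 ?divr_ge0// ?ler_pdivrMr ?mul1r//; lra.
Qed.

Lemma vec_diff_dominated {R : realType} (al p : R) : 1 < al -> exists2 K : R, 0 < K &
  forall (d : measure_display) (T : measurableType d) (P : probability T R)
    (J : finType) (Z : J -> T -> R),
  (forall j, measurable_fun setT (Z j)) ->
  dominated al p K (sqrt_dist (P \x P)%E (vec_diff_sq Z)) (sqrt_dist P (vec_sq Z)).
Proof.
move=> al1; have al0 : 0 < al by lra.
have w0 : 0 < weight al p 0 1 by exact: weight_gt0.
exists (2 * weight al p 0 1)^-1; first by rewrite invr_gt0 mulr_gt0.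
move=> d T P J Z mZ k l l0 H.
have := H (k + 1)%N; rewrite weight_addr => {}H.
have -> : l = 2 * (l / 2) by rewrite mulrC divfK.
apply: le_trans (vec_diff_dist_le P mZ _) _; first by rewrite divr_gt0.
have {}H : (sqrt_dist P (vec_sq Z) (l / 2) <= (2^-1 ^+ (k + 1))%:E)%E.
  apply: le_trans H; rewrite le_eqVlt; apply/orP; left; apply/eqP; congr sqrt_dist.
  by rewrite invfM divfK ?gt_eqF// mulrC.
apply: (@le_trans _ _ (2%:E * (2^-1 ^+ (k + 1))%:E)%E).
  by rewrite lee_pmul2l.
by rewrite -EFinM lee_fin addn1 exprS mulrA mulfV// mul1r.
Qed.

(** The hypothesis at all scales j bounds the mean of the symmetrized norm, by a series that
    converges because al * 2^(1/p) < 2; the scale k + 1 alone then gives the tail. *)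
Lemma vec_dominated {R : realType} (al p : R) : 0 < p -> 1 < al ->
  al < 2 `^ p^-1 -> al * 2 `^ p^-1 < 2 -> exists2 K : R, 0 < K &
  forall (d : measure_display) (T : measurableType d) (P : probability T R)
    (J : finType) (Z : J -> T -> R),
  (forall j, measurable_fun setT (Z j)) ->
  (forall j, P.-integrable setT (EFin \o Z j)) ->
  (forall j, (\int[P]_x (Z j x)%:E = 0)%E) ->
  dominated al p K (sqrt_dist P (vec_sq Z)) (sqrt_dist (P \x P)%E (vec_diff_sq Z)).
Proof.
move=> p0 al1 alb ab2; set b := 2 `^ p^-1 in alb ab2 *.
set th := al * b; have th1 : 1 < th by rewrite /th; nra.
have th2 : th < 2 by [].
pose A := 1 + th * (2 / (1 - th / 2)).
have A1 : 1 <= A by rewrite lerDl mulr_ge0 ?divr_ge0//; lra.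
(* [8 * A] brings the mean below l / 8, and [2 * th] the level at scale k + 1 below l / 2. *)
pose K := (8 * A + 2 * th)^-1.
have K0 : 0 < K by rewrite invr_gt0; lra.
have KE : K * (8 * A + 2 * th) = 1 by rewrite mulVf// gt_eqF//; lra.
have KA : K * A <= 8^-1 by nra.
have Kth : K * th <= 2^-1 by nra.
exists K => // d T P J Z mZ iZ Z0 k l l0 H.
have mV := measurable_vec_sq mZ; have mW := measurable_vec_diff_sq mZ.
have [_ dn] := is_distr_sqrt_dist (P \x P)%E mW.
have E2 : (\int[P \x P]_w (Num.sqrt (vec_diff_sq Z w))%:E <= (l / 8)%:E)%E.
  apply: (@le_trans _ _ (K * l * A)%:E).
    apply: integral_sqrt_levels => //; first by rewrite mulr_gt0.
    move=> j; apply: le_trans (H j); apply: dn.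
    rewrite mulrAC ler_wpM2l ?mulr_ge0 ?(ltW K0) ?(ltW l0)//.
    by apply: weight_le => //; exact: ltW.
  by rewrite lee_fin mulrAC -[leRHS]mulrC ler_wpM2r// ltW.
have l4 : 0 < l / 4 by rewrite divr_gt0.
have half : (sqrt_dist P (vec_sq Z) (l / 4) <= (2^-1)%:E)%E.
  rewrite -(@lee_pmul2l _ (l / 4)%:E) ?lte_fin//.
  apply: le_trans (markov_sqrt P mV l4) _.
  apply: le_trans (vec_norm_integral_le mZ iZ Z0) _.
  by apply: le_trans E2 _; rewrite -EFinM lee_fin; lra.
pose B := [set x | l < Num.sqrt (vec_sq Z x)].
pose S := [set x | l / 4 < Num.sqrt (vec_sq Z x)].
have mB : measurable B by exact: measurable_sqrt_gt.
have mS : measurable S by exact: measurable_sqrt_gt.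
have PS : ((2^-1)%:E <= P (~` S))%E.
  rewrite probability_setC// leeBrDl; last first.
    by rewrite ge0_fin_numE// (le_lt_trans half)// ltry.
  by apply: le_trans (leeD half (lexx _)) _; rewrite -EFinD lee_fin; lra.
(* |Z(x)| > l and |Z(y)| <= l / 4 force |Z(x) - Z(y)| > l / 2, and x, y are independent under the
   product measure. *)
have key : (P B * P (~` S) <= sqrt_dist (P \x P)%E (vec_diff_sq Z) (l / 2))%E.
  have <- : (P \x P)%E (B `*` ~` S) = (P B * P (~` S))%E.
    by apply: product_measure1E => //; exact: measurableC.
  apply: le_measure; rewrite ?inE.
  - by apply: measurableX => //; exact: measurableC.
  - exact: measurable_sqrt_gt.
  move=> [x y] /= [Bx /negP]; rewrite -leNgt => Sy.
  have Bx' : l ^+ 2 < vec_sq Z x.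
    rewrite -(sqr_sqrtr (vec_sq_ge0 Z x)).
    by rewrite ltrXn2r// ?nnegrE ?sqrtr_ge0// ltW.
  have Sy' : vec_sq Z y <= (l / 4) ^+ 2.
    rewrite -(sqr_sqrtr (vec_sq_ge0 Z y)).
    by rewrite lerXn2r// ?nnegrE ?sqrtr_ge0// ltW.
  have l2 : l / 2 = Num.sqrt ((l / 2) ^+ 2) by rewrite sqrtr_sqr ger0_norm// divr_ge0// ltW.
  have D : vec_sq Z x <= 2 * vec_diff_sq Z (x, y) + 2 * vec_sq Z y.
    rewrite /vec_sq !mulr_sumr -big_split /=; apply: ler_sum => j _ /=.
    by have := sqr_ge0 (Z j x - 2 * Z j y); nra.
  have D' : (l / 2) ^+ 2 < vec_diff_sq Z (x, y) by nra.
  by rewrite l2 ltr_sqrt// (le_lt_trans (sqr_ge0 _) D').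
have {}H : (sqrt_dist (P \x P)%E (vec_diff_sq Z) (l / 2) <= (2^-1 ^+ k.+1)%:E)%E.
  apply: le_trans (H k.+1); apply: dn.
  rewrite [weight _ _ _ _](_ : _ = th); last first.
    by rewrite -addn1 weight_addr /weight /ndist /= expr0 divr1 !expr1.
  by rewrite mulrC ler_wpM2l// ltW.
have := le_trans key H.
have : (P B * (2^-1)%:E <= P B * P (~` S))%E by rewrite lee_wpmul2l.
move=> /le_trans h /h; rewrite exprSr EFinM lee_pmul2r//.
Qed.

(** * Choice of the ratio [al] and proof of the theorem *)

Lemma lorentz_exponent_ex {R : realType} (p : R) : 1 < p ->
  exists al : R, [/\ 1 < al, al < 2 `^ p^-1 & al * 2 `^ p^-1 < 2].
Proof.
move=> p1; set b := 2 `^ p^-1.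
have p0 : 0 < p by lra.
have gt1 (s : R) : 0 < s -> 1 < 2 `^ s.
  move=> s0; have : 1 `^ s < 2 `^ s :> R.
    by apply: gt0_ltr_powR; rewrite ?nnegrE// ltr1n.
  by rewrite powR1.
have b1 : 1 < b by apply: gt1; rewrite invr_gt0.
have b0 : 0 < b by lra.
(* This is where p > 1 enters: both b and 2 / b exceed 1, and [al] is the midpoint of 1 and the
   smaller of them. *)
have b2 : b < 2.
  have -> : 2 = b * 2 `^ (1 - p^-1) :> R.
    rewrite /b -powRD; first by rewrite subrKC powRr1.
    by rewrite pnatr_eq0 implybT.
  by rewrite ltr_pMr// gt1// subr_gt0 invf_lt1.
have b2' : 1 < 2 / b by rewrite ltr_pdivlMr// mul1r.
have : (2 / b) * b = 2 by rewrite divfK// gt_eqF.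
move: (2 / b) b2' => t t1 tb; exists ((1 + Num.min b t) / 2).
by split; case: (leP b t) => h; nra.
Qed.

Lemma normcE {R : realType} (z : R[i]) :
  normc z = Num.sqrt (\sum_b coord b (complex_pair z) ^+ 2).
Proof. by case: z => u v; rewrite big_bool. Qed.

Lemma complex_pair_sum {R : realType} (I : finType) (z : I -> R[i]) b :
  coord b (complex_pair (\sum_i z i)) = \sum_i coord b (complex_pair (z i)).
Proof.
case: b; rewrite /coord /=.
  exact: (raddf_sum (@complex.Re R)).
exact: (raddf_sum (@complex.Im R)).
Qed.

Local Open Scope complex_scope.

Theorem theorem3p4 (R : realType) (p : R) (q : \bar R)
    (hp : 1 < p) (hq : (1%:E <= q)%E) :
  exists c C : R, 0 < c /\ 0 < C /\
  forall (d : measure_display) (T : measurableType d) (P : probability T R)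
    (N : nat) (X : 'I_N -> T -> R[i]),
    (1 <= N)%N ->
    (forall n, complex_rv (X n)) ->
    mutually_independent P (fun n => @complex_pair R \o X n) ->
    (forall n, centered P (X n)) ->
    let W : T -> R[i] := fun x => \sum_(n < N) X n x in
    let Q : T -> R[i] :=
      fun x => (Num.sqrt (\sum_(n < N) normc (X n x) ^+ 2))%:C in
    (c%:E * lorentz_norm P p q Q <= lorentz_norm P p q W)%E /\
    (lorentz_norm P p q W <= C%:E * lorentz_norm P p q Q)%E.
Proof.
have p0 : 0 < p by lra.
have [al [al1 alb ab2]] := lorentz_exponent_ex hp.
have [K1 K10 D1] := @square_sq_dominated R al p al1.
have [K2 K20 D2] := @sum_sq_dominated R al p al1 alb.
have [K3 K30 D3] := @vec_diff_dominated R al p al1.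
have [K4 K40 D4] := @vec_dominated R al p p0 al1 alb ab2.
have [C1 C10 L1] := lorentz_dominated al1 p0 K10 hq.
have [C2 C20 L2] := lorentz_dominated al1 p0 K20 hq.
have [C3 C30 L3] := lorentz_dominated al1 p0 K30 hq.
have [C4 C40 L4] := lorentz_dominated al1 p0 K40 hq.
(* [C4] passes to the symmetrization, [C1] and [C2] compare square function and sum on [T * T], [C3]
   returns to the original variables. *)
exists (C4 * (C1 * C3))^-1, (C4 * (C2 * C3)).
have CC0 : 0 < C4 * (C1 * C3) by rewrite !mulr_gt0.
split; first by rewrite invr_gt0.
split; first by rewrite !mulr_gt0.
move=> d T P N X _ mX indX cX W Q.
pose Y n := @complex_pair R \o X n.
(* The two real coordinates of the sum and, next, the 2N real coordinates of the family. *)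
pose ZW (b : bool) (x : T) : R := \sum_n coord b (Y n x).
pose ZQ (j : 'I_N * bool) (x : T) : R := coord j.2 (Y j.1 x).
have mcY n b : measurable_fun setT (fun x => coord b (Y n x)).
  exact: measurableT_comp (measurable_coord b) (mX n).
have icY n b : P.-integrable setT (EFin \o (fun x => coord b (Y n x))).
  by case: b; have [h1 h2 _ _] := cX n.
have zcY n b : (\int[P]_x (coord b (Y n x))%:E = 0)%E.
  have [_ _] := cX n; rewrite unlock => h1 h2.
  by case: b; [exact: h1|exact: h2].
have mZW b : measurable_fun setT (ZW b) by exact: measurable_sum.
have mZQ j : measurable_fun setT (ZQ j) by exact: mcY.
have iZW b : P.-integrable setT (EFin \o ZW b).
  rewrite (_ : _ \o _ = fun x => \sum_n (EFin \o (fun x => coord b (Y n x))) x)%E.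
    by apply: integrable_sum => // n _; exact: icY.
  by apply/funext => x /=; rewrite sumEFin.
have zZW b : (\int[P]_x (ZW b x)%:E = 0)%E.
  under eq_integral do rewrite -sumEFin.
  rewrite (integral_sum measurableT (fun n => icY n b)).
  by rewrite big1// => n _; exact: zcY.
have EW : distribution_fun P W = sqrt_dist P (vec_sq ZW).
  apply/funext => l; congr (P _); apply/seteqP; split => x /=;
    rewrite normcE; under eq_bigr do rewrite complex_pair_sum; done.
have EQ : distribution_fun P Q = sqrt_dist P (vec_sq ZQ).
  have EQx x : normc (Q x) = Num.sqrt (vec_sq ZQ x).
    rewrite /Q /= expr0n addr0 sqrtr_sqr ger0_norm ?sqrtr_ge0//; congr (Num.sqrt _).
    rewrite /vec_sq -(pair_bigA _ (fun n b => ZQ (n, b) x ^+ 2)) /=.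
    apply: eq_bigr => n _; rewrite normcE sqr_sqrtr//.
    by apply: sumr_ge0 => b _; exact: sqr_ge0.
  by apply/funext => l; congr (P _); apply/seteqP; split => x; rewrite /mkset EQx.
have SW : vec_diff_sq ZW = sum_sq Y.
  by apply/funext => w; apply: eq_bigr => b _; rewrite -sumrB.
have SQ : vec_diff_sq ZQ = square_sq Y.
  apply/funext => w; rewrite /vec_diff_sq /square_sq /sqnorm2.
  by rewrite -(pair_bigA _ (fun n b => (ZQ (n, b) w.1 - ZQ (n, b) w.2) ^+ 2)).
rewrite !lorentz_normE EW EQ.
have hW := is_distr_sqrt_dist P (measurable_vec_sq mZW).
have hQ := is_distr_sqrt_dist P (measurable_vec_sq mZQ).
have hSW := is_distr_sqrt_dist (P \x P)%E (measurable_sum_sq mX).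
have hSQ := is_distr_sqrt_dist (P \x P)%E (measurable_square_sq mX).
have d1 := D1 _ _ P _ Y mX indX.
have d2 := D2 _ _ P _ Y mX indX.
have d3W := D3 _ _ P _ ZW mZW; rewrite SW in d3W.
have d3Q := D3 _ _ P _ ZQ mZQ; rewrite SQ in d3Q.
have d4W := D4 _ _ P _ ZW mZW iZW zZW; rewrite SW in d4W.
have d4Q := D4 _ _ P _ ZQ mZQ (fun j => icY j.1 j.2) (fun j => zcY j.1 j.2).
rewrite SQ in d4Q.
split.
  (* The chain runs from Q through its symmetrization and that of the sum back to the sum. *)
  rewrite muleC lee_pdivrMr// muleC !EFinM -!muleA.
  apply: le_trans (L4 _ _ hQ hSQ d4Q) _; rewrite lee_pmul2l//.
  apply: le_trans (L1 _ _ hSQ hSW d1) _; rewrite lee_pmul2l//.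
  exact: L3 hSW hW d3W.
(* The same chain with the roles of sum and square function exchanged. *)
rewrite !EFinM -!muleA.
apply: le_trans (L4 _ _ hW hSW d4W) _; rewrite lee_pmul2l//.
apply: le_trans (L2 _ _ hSW hSQ d2) _; rewrite lee_pmul2l//.
exact: L3 hSQ hQ d3Q.
Qed.
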